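(* Let $X\neq\{0\}$ be a complex Banach space with unit ball $B_X$, let $n\ge 1$ be an integer, let $\beta>0$ be real with $\beta\neq1$, and let $R_\beta\in(0,1)$ be the positive root of the equation $$\frac{3\left(1-(1-r)^{1-\beta}\right)}{1-\beta}-\frac{2\left((1-r)^{-\beta}-1\right)}{\beta}=0 .$$ Let $a=(a_1,\dots,a_n)\in\overline{\mathbb{D}^n}$ and let $F:B_X\to\overline{\mathbb{D}^n}$ be a holomorphic mapping with $$F(z)=a+\sum_{s=1}^\infty P_s(z),\qquad z\in B_X,$$ where $P_s(z)=\frac{1}{s!}D^sF(0)(z^s)$. Assume that $|a_j|=\Vert a\Vert_\infty$ for all $j\in\{1,\dots,n\}$. Then the quantity $$\mathcal{C}_\beta^F(\Vert z\Vert):=\sum_{k=0}^\infty\frac{\Vert a\Vert_\infty\,\Gamma(k+\beta)}{\Gamma(k+2)\Gamma(\beta)}\Vert z\Vert^k+\sum_{N=1}^\infty\frac{1}{N+1}\left(\sum_{k=1}^N\frac{\Gamma(k-1+\beta)}{\Gamma(k)\Gamma(\beta)}\Vert z\Vert^{k-1}\,\Vert P_{N-k+1}(z)\Vert_\infty\right)$$ satisfies $$\mathcal{C}_\beta^F(\Vert z\Vert)\le\frac1r\left(\frac{1-(1-r)^{1-\beta}}{1-\beta}\right)$$ for all $z\in B_X$ with $\Vert z\Vert=r\le R_\beta$. The number $R_\beta$ cannot be improved, i.e. for every $R'\in(R_\beta,1)$ there exist a mapping $F$ satisfying all the hypotheses above (for the same $X$, $n$ and $\beta$) and a point $z\in B_X$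 with $\Vert z\Vert=r\le R'$ for which the inequality fails.
   Context: $\mathbb{D}=\{z\in\mathbb{C}:|z|<1\}$; $\mathbb{D}^n$ is the open unit polydisc in $\mathbb{C}^n$ and $\overline{\mathbb{D}^n}$ its closure. $\Vert w\Vert_\infty=\max_{1\le j\le n}|w_j|$ for $w\in\mathbb{C}^n$. $\Gamma$ is the Gamma function. $B_X=\{x\in X:\Vert x\Vert<1\}$. $D^sF(0)$ is the $s$-th Fréchet derivative of $F$ at $0$, a symmetric $s$-linear mapping $X^s\to\mathbb{C}^n$, and $D^sF(0)(z^s)$ means $D^sF(0)(z,\dots,z)$; thus $P_s$ is the $s$-homogeneous polynomial in the expansion of $F$ at the origin. The quantity $\mathcal{C}_\beta^F(\Vert z\Vert)$ (the majorant series associated with the $\beta$-Cesàro operator) depends on $z$, not only on $\Vert z\Vert$, despite the notation. At $r=0$ the right-hand side of the inequality is read as its limit $1$; convention $0^0=1$. *)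

(* Defs.v *)
From HB Require Import structures.
From mathcomp Require Import all_boot all_order all_algebra complex.
From mathcomp Require Import all_classical all_reals all_analysis.
Set Implicit Arguments.
Unset Strict Implicit.
Unset Printing Implicit Defensive.
Import Order.TTheory GRing.Theory Num.Theory numFieldNormedType.Exports.
Local Open Scope classical_set_scope.
Local Open Scope ring_scope.

Definition unit_ball (K : numFieldType) (X : normedModType K) : set X :=
  [set x | `|x| < 1].
Arguments unit_ball {K} X.

Definition holomorphic_on (K : numFieldType) (X Y : normedModType K)
    (U : set X) (F : X -> Y) : Prop :=
  forall x, U x -> differentiable F x.

(* Higher Frechet derivatives. A map X^s -> Y is a function on families
   v : 'I_s -> X, and L(X, L_s(X; Y)) is identified with L_{s+1}(X; Y): the
   argument consumed by the last differentiation is put in front.            *)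

Definition arg_cons (X : Type) (s : nat) (h : X) (v : 'I_s -> X) :
    'I_s.+1 -> X :=
  fun i => oapp v h (unlift ord0 i).

Definition multilinear_map (K : numFieldType) (X Y : normedModType K)
    (s : nat) (A : ('I_s -> X) -> Y) : Prop :=
  forall (v : 'I_s -> X) (i : 'I_s) (c : K) (u w : X),
    A (dfwith v i (c *: u + w)) = c *: A (dfwith v i u) + A (dfwith v i w).

Definition bounded_map (K : numFieldType) (X Y : normedModType K)
    (s : nat) (A : ('I_s -> X) -> Y) : Prop :=
  exists M : K, forall v : 'I_s -> X, (forall i, `|v i| <= 1) -> `|A v| <= M.

(* G takes values in s-linear maps. The quantification over v inside the
   neighbourhood says that the remainder is o(h) in the norm
   sup {|B v| : |v i| <= 1} of L_s(X; Y).                                    *)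
Definition is_frechet_derivative (K : numFieldType) (X Y : normedModType K)
    (s : nat) (G : X -> ('I_s -> X) -> Y) (x : X)
    (A : ('I_s.+1 -> X) -> Y) : Prop :=
  [/\ multilinear_map A, bounded_map A &
      forall e : K, 0 < e -> \forall h \near (0 : X),
        forall v : 'I_s -> X, (forall i, `|v i| <= 1) ->
          `|G (x + h) v - G x v - A (arg_cons h v)| <= e * `|h|].

(* [frechet_iter F s x] is D^s F(x); a derivative that does not exist is
   replaced by the zero map.                                                 *)
Fixpoint frechet_iter (K : numFieldType) (X Y : normedModType K)
    (F : X -> Y) (s : nat) : X -> ('I_s -> X) -> Y :=
  match s return X -> ('I_s -> X) -> Y with
  | 0 => fun x _ => F x
  | s'.+1 => fun x =>
      xget (fun=> 0)
        [set A | is_frechet_derivative (@frechet_iter K X Y F s') x A]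
  end.
Arguments frechet_iter {K X Y} F s x v.

Definition taylor_part (K : numFieldType) (X Y : normedModType K)
    (F : X -> Y) (s : nat) (z : X) : Y :=
  s`!%:R^-1 *: frechet_iter F s 0 (fun=> z).

Definition polydisc (K : numFieldType) (n : nat) : set 'rV[K]_n :=
  [set w | forall j, `|w 0 j| < 1].
Arguments polydisc K n : clear implicits.

(* The norm of 'rV[K]_n is the maximum norm. *)
Definition bohr_mapping (K : numFieldType) (X : normedModType K) (n : nat)
    (a : 'rV[K]_n) (F : X -> 'rV[K]_n) : Prop :=
  [/\ closure (polydisc K n) a,
      forall j, `|a 0 j| = `|a|,
      forall z, unit_ball X z -> closure (polydisc K n) (F z),
      holomorphic_on (unit_ball X) F &
      forall z, unit_ball X z ->
        (fun N => a + \sum_(1 <= s < N.+1) taylor_part F s z) @ \oo --> F z].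

Section Bohr.
Variable R : realType.

(* Norms over R[i] take their values in R[i]; this is the same norm as an
   element of R.                                                             *)
Definition rnorm (V : normedModType R[i]) (x : V) : R := complex.Re `|x|.

Definition Gamma (x : R) : R :=
  \int[lebesgue_measure]_(t in `]0, +oo[) (t `^ (x - 1) * expR (- t)).

(* All terms are nonnegative, so that the series are taken in [0, +oo]. *)
Definition cesaro_majorant (X : normedModType R[i]) (n : nat) (beta : R)
    (a : 'rV[R[i]]_n) (F : X -> 'rV[R[i]]_n) (z : X) : \bar R :=
  (\sum_(0 <= k <oo)
     (rnorm a * Gamma (k%:R + beta) / (Gamma (k%:R + 2) * Gamma beta)
        * rnorm z ^+ k)%:E
   + \sum_(1 <= N <oo)
     (N.+1%:R^-1 *
        \sum_(1 <= k < N.+1)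
          Gamma (k%:R - 1 + beta) / (Gamma k%:R * Gamma beta)
            * rnorm z ^+ (k - 1) * rnorm (taylor_part F (N - k + 1) z))%:E)%E.

Definition radius_equation (beta r : R) : Prop :=
  3 * (1 - (1 - r) `^ (1 - beta)) / (1 - beta)
    - 2 * ((1 - r) `^ (- beta) - 1) / beta = 0.

(* The value at 0 is the limit. *)
Definition cesaro_bound (beta r : R) : R :=
  if r == 0 then 1 else r^-1 * ((1 - (1 - r) `^ (1 - beta)) / (1 - beta)).

End Bohr.

(* Main.v *)
Require Import Defs.
From HB Require Import structures.
From mathcomp Require Import all_boot all_order all_algebra complex.
From mathcomp Require Import all_classical all_reals all_analysis.
From mathcomp Require Import cyclic separable cyclotomic measurable_realfun.
From mathcomp Require Import ring lra.
Import Order.TTheory GRing.Theory Num.Theory numFieldNormedType.Exports.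
Local Open Scope classical_set_scope.
Local Open Scope complex_scope.
Local Open Scope ring_scope.

(** Write r for the norm of z, A for (1 - (1 - r)^(1 - b)) / (1 - b), where b
    is the parameter beta, and B for ((1 - r)^(- b) - 1) / b. The weights
    Gamma (k + b) / (Gamma (k + 1) Gamma b) are the binomial coefficients of
    (1 - x)^(- b) ([Gamma_ratio], which needs the functional equation of the
    Gamma integral, [GammaS]). Summing the binomial series of (1 - x)^(- b)
    term by term ([binomial_series]) turns the first series of the majorant
    into `|a| A / r ([head_series]), and the second one, if the norm of
    P_s(z) is replaced by r^s, into (B - A) / r
    ([shifted_cesaro_partial_cvg]).

    Upper bound. It suffices to know that P_s(z) has norm at most (1 -
    `|a|^2) r^s: then r times the majorant is at most `|a| A + (1 - `|a|^2)
    (B - A), and this is at most A because (1 + `|a|) (B - A) <= 2 (B - A) <=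
    A. The last inequality is 3 A - 2 B >= 0, and the derivative of 3 A - 2 B
    in r is (1 - r)^(- b - 1) (1 - 3 r); so 3 A - 2 B increases from 0, then
    decreases, and changes sign exactly at the radius ([bohr_gap_sign]).

    The estimate of P_s(z) is one-dimensional. For fixed z and a coordinate j
    the function t |-> F(t z)_j is the sum of the power series with
    coefficients P_s(z)_j in the disc `|t| < 1 / r, and is bounded by 1
    there; its constant coefficient a_j has modulus `|a| for every j, which
    is where the hypothesis on a enters. For a power series bounded by 1 in
    the unit disc, with coefficients c_k, multiplication by the series is a
    contraction for the square mean on circles. Looking at the coefficients
    of index 0 and s only, the matrix with rows (c_0, 0) and (c_s, c_0) is a
    contraction, and this says precisely that `|c_s| <= 1 - `|c_0|^2. The
    square means are taken over roots of unity ([parseval_unity_roots]), so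
    that no integral and no Cauchy formula is needed
    ([bounded_power_series_coef]).

    Sharpness. Take the Moebius function f(w) = (al - w) / (1 - al w) with 0
    < al < 1 and a linear functional l of norm at most 1 with l(z) = `|z|
    ([hahn_banach_norming]), and let all the coordinates of F be f o l. The
    iterated Frechet derivatives of F are computed exactly on the whole ball
    ([frechet_iter_extremal]), so the norm of P_s(z) is (1 - al^2) al^(s - 1)
    r^s. As al tends to 1, the excess of r times the majorant over A, divided
    by 1 - al, tends to 2 (B - A) - A, which is positive beyond the radius; a
    finite section of the second series is enough to see this
    ([sharp_parameter]). *)

Set Implicit Arguments.
Unset Strict Implicit.
Unset Printing Implicit Defensive.

(** * Coefficients of bounded power series *)

Lemma prim_root_closed_exists (C : numClosedFieldType) (M : nat) :
  (0 < M)%N -> exists w : C, M.-primitive_root w.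
Proof.
move=> M0; pose p : {poly C} := 'X^M - 1.
have [rs Dp] := closed_field_poly_normal p.
rewrite (monicP _) ?monicXnsubC // scale1r in Dp.
have rs1 : all M.-unity_root rs.
  by apply/allP => z; rewrite -root_prod_XsubC -Dp.
have srs : (M < (size rs).+1)%N.
  by rewrite -(size_prod_XsubC rs id) -Dp size_XnsubC.
have [|z _ zM] := hasP (has_prim_root M0 rs1 _ srs); last by exists z.
rewrite -separable_prod_XsubC -Dp cyclotomic.separable_Xn_sub_1 //.
by rewrite pnatr_eq0 -lt0n.
Qed.

Lemma sum_pow_unity_root (C : numClosedFieldType) (M : nat) (u : C) :
  u ^+ M = 1 -> u != 1 -> \sum_(j < M) u ^+ j = 0.
Proof.
move=> uM u1; have /eqP := subrX1 u M.
by rewrite uM subrr eq_sym mulf_eq0 subr_eq0 (negPf u1) => /eqP.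
Qed.

Lemma norm_unity_root (C : numClosedFieldType) (M : nat) (w : C) :
  (0 < M)%N -> w ^+ M = 1 -> `|w| = 1.
Proof.
move=> M0 wM; apply/eqP; rewrite -(@pexpr_eq1 _ _ M) //.
by rewrite -normrX wM normr1.
Qed.

(** The size bound is what excludes aliasing: the M sampling points then
    separate the monomials of P. *)
Lemma parseval_unity_roots (C : numClosedFieldType) (M : nat) (w : C)
    (P : {poly C}) : M.-primitive_root w -> (size P <= M)%N ->
  \sum_(j < M) `|P.[w ^+ j]| ^+ 2 = M%:R * \sum_(k < M) `|P`_k| ^+ 2.
Proof.
move=> wM sP; have M0 := prim_order_gt0 wM.
have w1 : `|w| = 1 by apply: norm_unity_root M0 (prim_expr_order wM).
have wwJ : w * w^* = 1 by rewrite -normCK w1 expr1n.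
have wJ : w^* = w^-1.
  have w0 : w != 0 by rewrite -normr_eq0 w1 oner_eq0.
  by apply: (mulfI w0); rewrite wwJ divff.
have E j : `|P.[w ^+ j]| ^+ 2 =
    \sum_(k < M) \sum_(l < M) P`_k * (P`_l)^* * (w ^+ k / w ^+ l) ^+ j.
  rewrite normCK (horner_coef_wide _ sP) rmorph_sum mulr_suml.
  apply: eq_bigr => k _; rewrite mulr_sumr; apply: eq_bigr => l _.
  rewrite rmorphM !rmorphXn /= wJ !exprVn exprMn exprVn -!exprM !(mulnC j).
  rewrite !mulrA; congr (_ / _); exact: mulrAC.
under eq_bigr do rewrite E.
rewrite exchange_big mulr_sumr; apply: eq_bigr => k _ /=.
rewrite exchange_big (bigD1 k) //= [X in _ + X]big1 ?addr0 => [|l lk].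
  have -> : w ^+ k / w ^+ k = 1.
    by rewrite divff // expf_neq0 // -normr_eq0 w1 oner_eq0.
  under eq_bigr do rewrite expr1n mulr1.
  by rewrite sumr_const card_ord normCK mulr_natl.
rewrite -mulr_sumr sum_pow_unity_root ?mulr0 //.
  rewrite exprMn exprVn -!exprM !(mulnC _ M) !exprM (prim_expr_order wM).
  by rewrite !expr1n divr1.
have wl0 : w ^+ l != 0 by rewrite expf_neq0 // -normr_eq0 w1 oner_eq0.
rewrite -(inj_eq (mulIf wl0)) mulfVK // mul1r.
apply: contraNneq lk => /eqP; rewrite (eq_prim_root_expr wM).
by rewrite !modn_small // => /eqP kl; apply/eqP/val_inj.
Qed.

(** Multiplying S by x + y X^s does not increase square means by more than
    the factor E^2. By Parseval these means are sums over coefficients, of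
    which only those of index 0 and s are kept on the left-hand side. *)
Lemma poly_toeplitz_contraction (C : numClosedFieldType) (S : {poly C}) (E : C)
    (s : nat) (x y : C) : (0 < s)%N ->
  (forall z, `|z| = 1 -> `|S.[z]| <= E) ->
  `|S`_0 * x| ^+ 2 + `|S`_s * x + S`_0 * y| ^+ 2 <=
    E ^+ 2 * (`|x| ^+ 2 + `|y| ^+ 2).
Proof.
move=> s0 SE; pose p : {poly C} := x%:P + y *: 'X^s.
(* enough sampling points for both S * p and p to be recovered exactly *)
pose M := maxn (maxn (size (S * p)) (size p)) s.+1.
have M0 : (0 < M)%N by rewrite /M leq_max orbT.
have sM : (s < M)%N by rewrite /M leq_max leqnn orbT.
have [w wM] := prim_root_closed_exists C M0.
have w1 j : `|w ^+ j| = 1.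
  by rewrite normrX (norm_unity_root M0 (prim_expr_order wM)) expr1n.
have E0 : 0 <= E by apply: le_trans (SE 1 _); rewrite ?normr1.
have le1 : \sum_(j < M) `|(S * p).[w ^+ j]| ^+ 2 <=
           E ^+ 2 * \sum_(j < M) `|p.[w ^+ j]| ^+ 2.
  rewrite mulr_sumr; apply: ler_sum => j _.
  rewrite hornerM normrM exprMn ler_wpM2r ?exprn_ge0 //.
  by rewrite ler_pXn2r ?nnegrE ?SE.
have pk k : p`_k = x *+ (k == 0%N) + y *+ (k == s).
  by rewrite coefD coefC coefZ coefXn mulr_natr -[if _ then _ else _]mulrb.
have := le1; rewrite !parseval_unity_roots //; last 2 first.
- by rewrite !leq_max leqnn orbT.
- by rewrite !leq_max leqnn.
rewrite mulrCA ler_pM2l ?ltr0n //.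
have two (f : nat -> C) : (forall k, 0 <= f k) ->
    (forall k, k != 0%N -> k != s -> f k = 0) ->
    \sum_(k < M) f k = f 0%N + f s.
  move=> f0 fz; rewrite (bigD1 (Ordinal M0)) //= (bigD1 (Ordinal sM)) /=;
    last by rewrite -val_eqE /= -lt0n.
  rewrite big1 ?addr0 // => i /andP[i0 iS]; apply: fz.
    by rewrite -val_eqE in i0.
  by rewrite -val_eqE in iS.
rewrite (two (fun k => `|p`_k| ^+ 2)); last 2 first.
- by move=> k; rewrite exprn_ge0.
- by move=> k /negPf k0 /negPf ks; rewrite pk k0 ks !mulr0n addr0 normr0 expr0n.
have -> : p`_0 = x by rewrite pk eqxx eq_sym (gtn_eqF s0) addr0.
have -> : p`_s = y by rewrite pk eqxx (gtn_eqF s0) add0r.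
move=> le2; apply: le_trans le2.
have -> : S`_0 * x = (S * p)`_0.
  by rewrite coef0M pk eqxx eq_sym (gtn_eqF s0) addr0.
have -> : S`_s * x + S`_0 * y = (S * p)`_s.
  rewrite mulrDr coefD coefMC -scalerAr coefZ coefMXn ltnn subnn.
  by rewrite (mulrC y).
rewrite (bigD1 (Ordinal M0)) //= (bigD1 (Ordinal sM)) /=; last first.
  by rewrite -val_eqE /= -lt0n.
by rewrite addrA lerDl sumr_ge0 // => i _; rewrite exprn_ge0.
Qed.

(** A lower triangular 2 x 2 matrix with equal diagonal entries a, corner b
    and operator norm at most E; for E = 1 this is the inequality of Schwarz
    and Pick at the origin. *)
Lemma contraction_offdiag (C : numClosedFieldType) (a b E : C) : 0 <= E ->
  (forall x y, `|a * x| ^+ 2 + `|b * x + a * y| ^+ 2 <=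
    E ^+ 2 * (`|x| ^+ 2 + `|y| ^+ 2)) ->
  E * `|b| <= E ^+ 2 - `|a| ^+ 2.
Proof.
move=> E0 H.
have aE : `|a| ^+ 2 <= E ^+ 2.
  have := H 1 0; rewrite !mulr0 !mulr1 !addr0 normr0 normr1 expr1n expr0n /=.
  by rewrite addr0 mulr1 => /(le_trans _); apply; rewrite lerDl exprn_ge0.
set d := E ^+ 2 - `|a| ^+ 2.
have d0 : 0 <= d by rewrite subr_ge0.
(* the vector (d, a^* b) is the one that the critical contraction, with
   E * `|b| = d, maps to a vector of E times its length *)
have := H d (a^* * b).
have -> : b * d + a * (a^* * b) = b * E ^+ 2.
  by rewrite /d normCK; ring.
rewrite (normrM a) (normrM b) (normrM a^*) (ger0_norm d0) normrX.
rewrite (ger0_norm E0) norm_conjC => Hd.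
have {Hd} : d * (E * `|b|) ^+ 2 <= d * d ^+ 2.
  rewrite -subr_ge0 in Hd; rewrite -subr_ge0.
  suff -> : d * d ^+ 2 - d * (E * `|b|) ^+ 2 =
      E ^+ 2 * (d ^+ 2 + (`|a| * `|b|) ^+ 2) -
      ((`|a| * d) ^+ 2 + (`|b| * E ^+ 2) ^+ 2) by [].
  by rewrite /d; ring.
have [d00|dn0] := eqVneq d 0; last first.
  by rewrite ler_pM2l ?lt_def ?dn0 // ler_pXn2r ?nnegrE ?mulr_ge0.
move=> _.
have := H 1 0; rewrite !mulr0 !mulr1 !addr0 normr0 normr1 expr1n expr0n /=.
rewrite addr0 mulr1 -lerBrDl -/d d00 -normrX normr_le0 sqrf_eq0 => /eqP ->.
by rewrite normr0 mulr0.
Qed.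

(** Pointwise convergence at one point t' of larger modulus bounds the terms
    there, so that on the circle of radius t the tails are dominated by a
    geometric series; the partial sums are then uniformly close to f on that
    circle. *)
Lemma power_series_uniform_bound (C : numClosedFieldType) (c : nat -> C)
    (f : C -> C) (rho t e : C) :
  (forall q : C, `|q| < 1 -> (fun N => q ^+ N) @ \oo --> (0 : C)) ->
  0 < t -> t < rho -> 0 < e ->
  (forall l, `|l| < rho -> `|f l| <= 1) ->
  (forall l, `|l| < rho ->
     (fun N => \sum_(0 <= k < N) c k * l ^+ k) @ \oo --> f l) ->
  exists N0 : nat, forall N z, (N0 <= N)%N -> `|z| = t ->
    `|\sum_(0 <= k < N) c k * z ^+ k| <= 1 + e.
Proof.
move=> geo t0 trho e0 f1 cf.
have e20 : 0 < e / 2 by rewrite divr_gt0.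
pose t' := (t + rho) / 2.
have [tt' t'rho] : t < t' /\ t' < rho.
  by split; rewrite ?midf_lt.
have t'0 : 0 < t' by apply: lt_trans tt'.
pose q := t / t'.
have q0 : 0 < q by rewrite divr_gt0.
have q1 : q < 1 by rewrite ltr_pdivrMr ?mul1r.
have q10 : 0 < 1 - q by rewrite subr_gt0.
(* the terms at t' tend to 0, hence are eventually at most 2 *)
have [N1 HN1] : exists N1, forall k, (N1 <= k)%N -> `|c k| * t' ^+ k <= 2.
  have t'n : `|t'| < rho by rewrite gtr0_norm.
  have /cvgrPdist_lt /(_ 1 ltr01) [N1 _ HN1] := cf t' t'n.
  exists N1 => k kN; have -> : `|c k| * t' ^+ k = `|c k * t' ^+ k|.
    by rewrite normrM normrX (gtr0_norm t'0).
  have -> : c k * t' ^+ k = (f t' - \sum_(0 <= k < k) c k * t' ^+ k) -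
     (f t' - \sum_(0 <= k < k.+1) c k * t' ^+ k).
    by rewrite big_nat_recr //=; ring.
  apply: le_trans (ler_normB _ _) _; rewrite -[2]/(1 + 1).
  by apply: lerD; apply/ltW/HN1 => //; exact: leqW.
have [N2 HN2] : exists N2, forall N, (N2 <= N)%N -> q ^+ N < (1 - q) * (e / 4).
  have /geo /cvgrPdist_lt /(_ ((1 - q) * (e / 4))) [|N2 _ HN2] : `|q| < 1.
  - by rewrite gtr0_norm.
  - by rewrite mulr_gt0 // divr_gt0.
  exists N2 => N /HN2 /=; rewrite sub0r normrN ger0_norm //.
  by rewrite exprn_ge0 // ltW.
exists (maxn N1 N2) => N z; rewrite geq_max => /andP[N1N N2N] zt.
have zrho : `|z| < rho by rewrite zt.
have tail M : (N <= M)%N ->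
    `|\sum_(N <= k < M) c k * z ^+ k| <= e / 2.
  move=> NM; apply: le_trans (ler_norm_sum _ _ _) _.
  have /le_trans : \sum_(N <= k < M) `|c k * z ^+ k| <=
      \sum_(N <= k < M) 2 * q ^+ k.
    rewrite !big_nat; apply: ler_sum => k /andP[Nk _].
    rewrite normrM normrX zt.
    have -> : t = t' * q by rewrite /q mulrCA divff ?mulr1 ?gt_eqF.
    rewrite exprMn mulrA ler_pM2r ?exprn_gt0 //.
    by apply: HN1; apply: leq_trans N1N Nk.
  apply; rewrite -mulr_sumr.
  have geo' : (1 - q) * \sum_(N <= k < M) q ^+ k = q ^+ N - q ^+ M.
    have := telescope_sumr (fun k => q ^+ k) NM; rewrite /= => /(congr1 -%R).
    rewrite opprB -sumrN mulr_sumr => <-.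
    by apply: eq_bigr => k _; rewrite exprS; ring.
  rewrite -(ler_pM2l q10) mulrCA geo'.
  apply: (@le_trans _ _ (2 * q ^+ N)).
    by rewrite ler_pM2l // gerBl exprn_ge0 // ltW.
  have -> : (1 - q) * (e / 2) = 2 * ((1 - q) * (e / 4)) by field.
  by rewrite ler_pM2l // ltW ?HN2.
have /cvgrPdist_lt /(_ _ e20) [N3 _ HN3] := cf z zrho.
have := HN3 (maxn N N3) (leq_maxr _ _) => /= {}HN3.
have NM := leq_maxl N N3; set M := maxn N N3 in HN3 NM.
have -> : \sum_(0 <= k < N) c k * z ^+ k = f z -
   (f z - \sum_(0 <= k < M) c k * z ^+ k) - \sum_(N <= k < M) c k * z ^+ k.
  by rewrite (big_cat_nat _ NM) //=; ring.
apply: le_trans (ler_normB _ _) _.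
rewrite [e]splitr addrA lerD ?tail //.
by apply: le_trans (ler_normB _ _) _; rewrite lerD ?f1 // ltW.
Qed.

(** The contraction estimate is applied to the partial sums on circles of
    radius t < rho, whose bound 1 + d tends to 1, before t tends to rho. The
    hypothesis on geometric sequences says that C is archimedean. *)
Lemma bounded_power_series_coef (C : numClosedFieldType) (c : nat -> C)
    (f : C -> C) (rho : C) :
  (forall q : C, `|q| < 1 -> (fun N => q ^+ N) @ \oo --> (0 : C)) -> 0 < rho ->
  (forall l, `|l| < rho -> `|f l| <= 1) ->
  (forall l, `|l| < rho ->
     (fun N => \sum_(0 <= k < N) c k * l ^+ k) @ \oo --> f l) ->
  forall s, (0 < s)%N -> `|c s| * rho ^+ s <= 1 - `|c 0%N| ^+ 2.
Proof.
move=> geo rho0 f1 cf s s0.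
have step t : 0 < t -> t < rho -> `|c s| * t ^+ s <= 1 - `|c 0%N| ^+ 2.
  move=> t0 trho; apply/ler_addgt0Pr => e e0.
  (* d <= 1 and 3 * d <= e, so that (1 + d) ^+ 2 <= 1 + e *)
  pose d := e / (e + 3).
  have e30 : 0 < e + 3 by rewrite addr_gt0.
  have d0 : 0 < d by rewrite divr_gt0.
  have d1 : d <= 1 by rewrite ler_pdivrMr // mul1r lerDl.
  have d3 : 3 * d <= e.
    by rewrite /d mulrA ler_pdivrMr // mulrC ler_pM2l // lerDr ltW.
  have [N0 HN0] := power_series_uniform_bound geo t0 trho d0 f1 cf.
  pose N := maxn N0 s.+1.
  pose S : {poly C} := \poly_(k < N) (c k * t ^+ k).
  have sN : (s < N)%N by rewrite leq_max leqnn orbT.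
  have SE z : `|z| = 1 -> `|S.[z]| <= 1 + d.
    move=> z1; rewrite horner_poly.
    rewrite -(big_mkord xpredT (fun k => c k * t ^+ k * z ^+ k)).
    have -> : \sum_(0 <= k < N) c k * t ^+ k * z ^+ k =
        \sum_(0 <= k < N) c k * (t * z) ^+ k.
      by apply: eq_bigr => k _; rewrite exprMn mulrA.
    by apply: HN0; rewrite ?leq_maxl // normrM z1 mulr1 gtr0_norm.
  have Sk k : (k < N)%N -> S`_k = c k * t ^+ k by move=> kN; rewrite coef_poly kN.
  have d10 : 0 <= 1 + d by rewrite addr_ge0 // ltW.
  have := contraction_offdiag d10
    (fun x y => poly_toeplitz_contraction x y s0 SE).
  rewrite !Sk ?(ltn_trans s0 sN) // expr0 mulr1 normrM normrX (gtr0_norm t0) => H.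
  apply: (@le_trans _ _ ((1 + d) * (`|c s| * t ^+ s))).
    by rewrite ler_peMl ?mulr_ge0 ?exprn_ge0 ?(ltW t0) // lerDl ltW.
  apply: (le_trans H); rewrite addrAC lerD2r.
  have -> : (1 + d) ^+ 2 = 1 + (2 * d + d * d) by ring.
  rewrite lerD2l (le_trans _ d3) //.
  have -> : 3 * d = 2 * d + 1 * d by ring.
  by rewrite lerD2l ler_pM2r.
have [->|cs0] := eqVneq (c s) 0.
  have h0 : 0 < rho / 2 by rewrite divr_gt0.
  have h1 : rho / 2 < rho by rewrite ltr_pdivrMr // ltr_pMr // ltr1n.
  rewrite normr0 mul0r; apply: le_trans (step _ h0 h1).
  by rewrite mulr_ge0 // exprn_ge0 // ltW.
apply/ler_addgt0Pr => e e0.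
have /derivable1_diffP/differentiable_continuous := @exprn_derivable C s rho 1.
move=> /cvgrPdist_lt /(_ (e / `|c s|)) [|r r0 Hr].
  by rewrite divr_gt0 ?normr_gt0.
have rrho0 : 0 < rho + r by rewrite addr_gt0.
(* a positive number below both rho and r *)
pose m := rho * r / (rho + r).
have m0 : 0 < m by rewrite divr_gt0 ?mulr_gt0.
have mrho : m < rho by rewrite ltr_pdivrMr // ltr_pM2l // ltrDr.
have mr : m < r by rewrite ltr_pdivrMr // mulrC ltr_pM2l // ltrDl.
have t0 : 0 < rho - m by rewrite subr_gt0.
have trho : rho - m < rho by rewrite gtrBl.
have /Hr /= : ball_ (fun x : C => `|x|) rho r (rho - m).
  by rewrite /ball_ /= opprB addrC subrK gtr0_norm.
have pos : 0 <= rho ^+ s - (rho - m) ^+ s.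
  by rewrite subr_ge0 ler_pXn2r ?nnegrE ?(ltW trho) // ltW.
rewrite ger0_norm // ltr_pdivlMr ?normr_gt0 // mulrBl => /ltW.
rewrite lerBlDl mulrC => /le_trans; apply.
by rewrite mulrC lerD2r step.
Qed.

(** * Norming functionals *)

Lemma rnormE (R : realType) (V : normedModType R[i]) (x : V) :
  `|x| = (rnorm x)%:C.
Proof. by rewrite /rnorm RRe_real ?normr_real. Qed.

Lemma rnorm_ge0 (R : realType) (V : normedModType R[i]) (x : V) : 0 <= rnorm x.
Proof. by rewrite -ler0c -rnormE. Qed.

Lemma rnormD (R : realType) (V : normedModType R[i]) (x y : V) :
  rnorm (x + y) <= rnorm x + rnorm y.
Proof. by rewrite -lecR rmorphD /= -!rnormE ler_normD. Qed.

Lemma rnormZ (R : realType) (V : normedModType R[i]) (t : R) (x : V) :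
  rnorm (t%:C *: x) = `|t| * rnorm x.
Proof.
apply: (@complexI R); rewrite rmorphM /= -!rnormE normrZ; congr (_ * _).
by rewrite normc_def /= expr0n addr0 sqrtr_sqr.
Qed.

(** Encoding partial real-linear functionals as graphs makes the union of a
    chain an upper bound in the sense of Zorn's lemma; that a graph is
    single-valued follows from the bound by the norm. *)
Definition bounded_linear_graph (R : realType) (X : normedModType R[i])
    (G : set (X * R)) : Prop :=
  [/\ forall x y a b, G (x, a) -> G (y, b) -> G (x + y, a + b),
      forall t x a, G (x, a) -> G (t%:C *: x, t * a) &
      forall x a, G (x, a) -> a <= rnorm x].

Section HahnBanach.
Variables (R : realType) (X : normedModType R[i]).
Implicit Types (G : set (X * R)) (x y z : X) (a b t : R).

Lemma bounded_linear_graph_fun G x a b :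
  bounded_linear_graph G -> G (x, a) -> G (x, b) -> a = b.
Proof.
move=> [GD GZ Gle].
suff le c d : G (x, c) -> G (x, d) -> c <= d.
  by move=> Ga Gb; apply/le_anti; rewrite !le.
move=> Gc /(GZ (-1)) Gd; have := Gle _ _ (GD _ _ _ _ Gc Gd).
rewrite rmorphN rmorph1 scaleN1r subrr mulN1r /rnorm normr0 /=.
by rewrite subr_le0.
Qed.

(** The value s at x0 has to lie between all a - `|x - x0| and all `|y + x0|
    - b, for (x, a) and (y, b) in G; these bounds are compatible by the
    triangle inequality. *)
Lemma bounded_linear_graph_extend G x0 : G !=set0 -> bounded_linear_graph G ->
  exists H, [/\ bounded_linear_graph H, G `<=` H & exists a, H (x0, a)].
Proof.
move=> [[x1 a1] G1] [GD GZ Gle].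
have G0 : G (0, 0) by have := GZ 0 _ _ G1; rewrite rmorph0 scale0r mul0r.
pose A := [set p.2 - rnorm (p.1 - x0) | p in G].
have AB x a y b : G (x, a) -> G (y, b) -> a - rnorm (x - x0) <= rnorm (y + x0) - b.
  move=> Ga Gb; rewrite lerBlDr addrAC lerBrDr.
  apply: (le_trans (Gle _ _ (GD _ _ _ _ Ga Gb))).
  have -> : x + y = (y + x0) + (x - x0) by rewrite addrACA subrr addr0 addrC.
  exact: rnormD.
have ubA : has_ubound A.
  exists (rnorm (0 + x0) - 0) => _ [[x a] Ga <-]; exact: AB.
have A0 : A !=set0 by exists (a1 - rnorm (x1 - x0)), (x1, a1).
pose s := sup A.
have sle x a : G (x, a) -> a - rnorm (x - x0) <= s.
  by move=> Ga; apply: ub_le_sup => //; exists (x, a).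
have les y b : G (y, b) -> s <= rnorm (y + x0) - b.
  by move=> Gb; apply: ge_sup => // _ [[x a] Ga <-]; exact: AB.
pose H := [set p | exists x a t, G (x, a) /\ p = (x + t%:C *: x0, a + t * s)].
exists H; split; last first.
- by exists s, 0, 0, 1; rewrite rmorph1 scale1r mul1r !add0r.
- by move=> [x a] Ga; exists x, a, 0; rewrite rmorph0 scale0r mul0r !addr0.
split.
- move=> _ _ _ _ [x [a [t [Ga [-> ->]]]]] [y [b [u [Gb [-> ->]]]]].
  exists (x + y), (a + b), (t + u); split; first exact: GD.
  by rewrite rmorphD scalerDl mulrDl; congr (_, _); rewrite addrACA.
- move=> u _ _ [x [a [t [Ga [-> ->]]]]].
  exists (u%:C *: x), (u * a), (u * t); split; first exact: GZ.
  by rewrite scalerDr scalerA rmorphM mulrDr mulrA.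
- move=> _ _ [x [a [t [Ga [-> ->]]]]].
  have [t0|t0|->] := ltgtP t 0; last first.
  + by rewrite rmorph0 scale0r mul0r !addr0; exact: Gle.
  + have := les _ _ (GZ t^-1 _ _ Ga); rewrite lerBrDr addrC.
    rewrite -(ler_pM2l t0) mulrDr mulVKf ?gt_eqF // => /le_trans; apply.
    rewrite -[X in X * _](gtr0_norm t0) -rnormZ scalerDr scalerA -rmorphM.
    by rewrite divff ?gt_eqF // scale1r.
  + have := sle _ _ (GZ (- t)^-1 _ _ Ga); have nt0 : 0 < - t by rewrite oppr_gt0.
    rewrite lerBlDl -lerBlDr -(ler_pM2l nt0) mulrBr mulVKf ?gt_eqF //.
    rewrite mulNr opprK => /le_trans; apply.
    rewrite -[X in X * _](gtr0_norm nt0) -rnormZ scalerBr scalerA -rmorphM.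
    by rewrite divff ?gt_eqF // scale1r rmorphN scaleNr opprK.
Qed.

(** The premise in P that a nonempty graph contains the base point lets the
    empty chain, whose union is empty, be treated like the others. *)
Lemma hahn_banach_real z : exists u : X -> R,
  [/\ forall x y, u (x + y) = u x + u y, forall t x, u (t%:C *: x) = t * u x,
      forall x, u x <= rnorm x & u z = rnorm z].
Proof.
pose P G := bounded_linear_graph G /\ (G !=set0 -> G (z, rnorm z)).
have [F FP totF|G [[Glin Gz] Gmax]] := @Zorn_bigcup _ P.
  split; last first.
    move=> [p [G FG Gp]]; exists G => //; have [_] := FP _ FG; apply; by exists p.
  split.
  - move=> x y a b [G FG Ga] [H FH Hb].
    have [GH|HG] := totF _ _ FG FH.
      by exists H => //; have [[HD _ _] _] := FP _ FH; apply: HD => //; apply: GH.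
    by exists G => //; have [[GD _ _] _] := FP _ FG; apply: GD => //; apply: HG.
  - move=> t x a [G FG Ga]; exists G => //.
    by have [[_ GZ _] _] := FP _ FG; apply: GZ.
  - by move=> x a [G FG Ga]; have [[_ _ Gle] _] := FP _ FG; apply: Gle.
have maxG H : G `<=` H -> P H -> H `<=` G.
  move=> GH PH; apply: contrapT => nHG; apply: (Gmax H) => //.
have G0 : G !=set0.
  apply: contrapT => nG0.
  pose L := [set p : X * R | exists t, p = (t%:C *: z, t * rnorm z)].
  have Lz : L (z, rnorm z) by exists 1; rewrite rmorph1 scale1r mul1r.
  apply: (nG0); exists (z, rnorm z); apply: (maxG L) => //.
    by move=> p Gp; exfalso; apply: (nG0); exists p.
  split => //; split.
  - move=> _ _ _ _ [t [-> ->]] [u [-> ->]]; exists (t + u).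
    by rewrite rmorphD scalerDl mulrDl.
  - by move=> u _ _ [t [-> ->]]; exists (u * t); rewrite rmorphM scalerA mulrA.
  - move=> _ _ [t [-> ->]]; rewrite rnormZ ler_wpM2r ?rnorm_ge0 //.
    exact: ler_norm.
have dom x : exists a, G (x, a).
  have [H [Hlin GH [a Ha]]] := bounded_linear_graph_extend x G0 Glin.
  exists a; apply: (maxG H) => //; split => // _; exact/GH/Gz.
have [u Gu] := choice dom.
have uE x a : G (x, a) -> u x = a by apply: bounded_linear_graph_fun.
have [GD GZ Gle] := Glin.
exists u; split => [x y|t x|x|].
- by apply: uE; apply: GD.
- by apply: uE; apply: GZ.
- exact: Gle.
- by apply: uE; apply: Gz.
Qed.

(** The complex functional is recovered from its real part u by l x = u x - i
    u (i x). *)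
Lemma hahn_banach_norming z : exists l : X -> R[i],
  [/\ forall c x y, l (c *: x + y) = c * l x + l y,
      forall x, `|l x| <= `|x| & l z = `|z|].
Proof.
have [u [uD uZ ule uz]] := hahn_banach_real z.
pose l x := u x +i* (- u ('i *: x)).
have lD x y : l (x + y) = l x + l y.
  by rewrite /l scalerDr !uD opprD.
have lR t x : l (t%:C *: x) = t%:C * l x.
  rewrite /l scalerA mulrC -scalerA !uZ; apply/eqP; rewrite eq_complex /=.
  by rewrite !mul0r subr0 addr0 mulrN !eqxx.
have li x : l ('i *: x) = 'i * l x.
  rewrite /l scalerA -expr2 sqr_i -[-1]/(- (1%:C)) -rmorphN uZ mulN1r opprK.
  by apply/eqP; rewrite eq_complex /= !mul0r !mul1r sub0r add0r opprK !eqxx.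
have lZ c x : l (c *: x) = c * l x.
  rewrite [c in LHS]complexE scalerDl lD -scalerA li !lR [c in RHS]complexE.
  by rewrite mulrDl mulrA.
have lle x : `|l x| <= `|x|.
  have [->|lx0] := eqVneq (l x) 0; first by rewrite normr0.
  (* rotate x so that l x becomes real, where the bound on u applies *)
  pose c := `|l x| / l x.
  have c1 : `|c| = 1 by rewrite normrM normrV ?unitfE // normr_id divff ?normr_eq0.
  have lcx : l (c *: x) = `|l x| by rewrite lZ mulfVK.
  have -> : `|x| = `|c *: x| by rewrite normrZ c1 mul1r.
  have : `|l x| = (u (c *: x))%:C.
    by rewrite -(RRe_real (normr_real (l x))) -lcx.
  by move=> ->; rewrite rnormE lecR.
exists l; split => [c x y||] //; first by rewrite lD lZ.
(* the real part of l z is already the norm bound, so the imaginary one is 0 *)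
have := lle z; rewrite normc_def /l /= uz rnormE lecR => le1.
apply/eqP; rewrite eq_complex /= eqxx /=.
rewrite -sqrf_eq0 sqrrN eq_le sqr_ge0 andbT.
have : Num.sqrt (rnorm z ^+ 2 + (- u ('i *: z)) ^+ 2) ^+ 2 <= rnorm z ^+ 2.
  by rewrite ler_pXn2r ?nnegrE ?sqrtr_ge0 ?rnorm_ge0.
by rewrite sqr_sqrtr ?addr_ge0 ?sqr_ge0 // sqrrN gerDl.
Qed.

End HahnBanach.

(** * Taylor parts of bounded mappings *)

Section Multilinear.
Variables (K : numFieldType) (X Y : normedModType K).

Lemma multilinear_zero s (A : ('I_s -> X) -> Y) v i :
  multilinear_map A -> A (dfwith v i 0) = 0.
Proof.
move=> lA; have := lA v i 1 0 0; rewrite scaler0 addr0 scale1r => /eqP.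
by rewrite -subr_eq0 opprD addNKr oppr_eq0 => /eqP.
Qed.

Lemma multilinear_scale1 s (A : ('I_s -> X) -> Y) v i c u :
  multilinear_map A -> A (dfwith v i (c *: u)) = c *: A (dfwith v i u).
Proof.
by move=> lA; have := lA v i c u 0; rewrite addr0 multilinear_zero // addr0.
Qed.

(** The arguments are scaled one at a time: w m has the first m of them
    scaled. *)
Lemma multilinear_scale s (A : ('I_s -> X) -> Y) (v : 'I_s -> X) (c : K) :
  multilinear_map A -> A (fun i => c *: v i) = c ^+ s *: A v.
Proof.
move=> lA.
pose w m := fun i : 'I_s => if (i < m)%N then c *: v i else v i.
suff H m : (m <= s)%N -> A (w m) = c ^+ m *: A v.
  rewrite -H //; congr A; apply/funext => i; by rewrite /w ltn_ord.
elim: m => [_|m IH ms]; first by rewrite expr0 scale1r.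
have wm : w m = dfwith (w m) (Ordinal ms) (v (Ordinal ms)).
  apply/funext => i; case: dfwithP => [|j _] //=.
  by rewrite /w /= ltnn.
have wS : w m.+1 = dfwith (w m) (Ordinal ms) (c *: v (Ordinal ms)).
  apply/funext => i; case: dfwithP => [|j ij]; first by rewrite /w /= ltnSn.
  rewrite /w ltnS leq_eqVlt; case: eqP => //= jm.
  by case/eqP: ij; apply/val_inj.
by rewrite wS multilinear_scale1 // -wm IH ?(ltnW ms) // scalerA exprS.
Qed.

(** Holds whether or not the derivatives exist, as a missing one is replaced
    by the zero map. *)
Lemma taylor_part_homogeneous (F : X -> Y) s c z :
  taylor_part F s (c *: z) = c ^+ s *: taylor_part F s z.
Proof.
rewrite /taylor_part scalerA mulrC -scalerA; congr (_ *: _).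
case: s => [|s] /=; first by rewrite expr0 scale1r.
case: xgetP => [A _ [lA _ _]|_]; last by rewrite scaler0.
exact: multilinear_scale.
Qed.

End Multilinear.

Lemma closure_polydisc_le1 (K : numFieldType) n (w : 'rV[K]_n) j :
  closure (polydisc K n) w -> `|w 0 j| <= 1.
Proof.
move=> cw; apply/ler_addgt0Pr => e e0.
have [p [pP]] := cw _ (nbhsx_ballx w e e0).
move=> /= [_ wp]; have /= {}wp := wp 0 j.
have -> : w 0 j = p 0 j + (w 0 j - p 0 j) by rewrite addrC subrK.
by apply: le_trans (ler_normD _ _) _; rewrite lerD // ltW // pP.
Qed.

(** Proved from the fact that a nonzero norm is attained at some entry,
    because K is only partially ordered. *)
Lemma mx_norm_le (K : numFieldType) n (w : 'rV[K]_n) (e : K) : 0 <= e ->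
  (forall j, `|w 0 j| <= e) -> `|w| <= e.
Proof.
move=> e0 we; have [w0|/mx_norm_neq0[[i j] /= wE]] := eqVneq (mx_norm w) 0.
  by rewrite -[`|w|]/(mx_norm w) w0.
by rewrite -[`|w|]/(mx_norm w) wE ord1.
Qed.

Lemma norm_const_mx (K : numFieldType) n (c : K) : (0 < n)%N ->
  `|const_mx c : 'rV[K]_n| = `|c|.
Proof.
move=> n0; set w : 'rV[K]_n := const_mx c.
have [w0|/mx_norm_neq0[[i j] /= wE]] := eqVneq (mx_norm w) 0; last first.
  by rewrite -[`|w|]/(mx_norm w) wE mxE.
rewrite -[`|w|]/(mx_norm w) w0; have /matrixP/(_ 0 (Ordinal n0)) := mx_norm_eq0 w0.
by rewrite !mxE => ->; rewrite normr0.
Qed.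

(** Norms in R[i] are embedded reals, which reduces the claim to the real
    case. *)
Lemma complex_geometric (R : realType) (q : (R[i] : numClosedFieldType)) :
  `|q| < 1 -> (fun N => q ^+ N) @ \oo --> (0 : (R[i] : numClosedFieldType)).
Proof.
move=> q1; apply/cvgrPdist_lt => e e0.
pose p := complex.Re `|q|.
have qE : `|q| = p%:C by rewrite RRe_real ?normr_real.
have eE : e = (complex.Re e)%:C by rewrite RRe_real ?gtr0_real.
rewrite qE -[1]/(1%:C) ltcR in q1; rewrite eE -[0]/(0%:C) ltcR in e0.
have p0 : 0 <= p by rewrite -ler0c -qE.
have := @cvg_expr R p; rewrite ger0_norm // => /(_ q1) /cvgrPdist_lt /(_ _ e0).
move=> -[N0 _ HN]; exists N0 => // N N0N.
rewrite /= sub0r normrN normrX qE eE -rmorphXn /= ltcR.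
by have := HN N N0N; rewrite /= sub0r normrN ger0_norm ?exprn_ge0.
Qed.

(** By homogeneity of the Taylor parts, each coordinate of F on the complex
    line through z is a power series in the line parameter, convergent and
    bounded by 1 in the disc of radius 1 / `|z|. *)
Lemma bohr_mapping_taylor_le_gen (C : numClosedFieldType)
    (X : normedModType C) (n : nat)
    (a : 'rV[C]_n) (F : X -> 'rV[C]_n) (z : X) (s : nat) :
  (forall q : C, `|q| < 1 -> (fun N => q ^+ N) @ \oo --> (0 : C)) ->
  (0 < n)%N -> bohr_mapping a F -> unit_ball X z -> (0 < s)%N ->
  `|taylor_part F s z| <= (1 - `|a| ^+ 2) * `|z| ^+ s.
Proof.
move=> geo n0 [clA aE FD _ FT] zB s0.
have [z0|z0] := eqVneq z 0.
  rewrite z0 -(scale0r (0 : X)) taylor_part_homogeneous scale0r.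
  by rewrite expr0n (gtn_eqF s0) scale0r !normr0 expr0n (gtn_eqF s0) mulr0.
have nz : 0 < `|z| by rewrite normr_gt0.
pose j0 := Ordinal n0.
have a1 : `|a| <= 1 by rewrite -(aE j0) closure_polydisc_le1.
apply: mx_norm_le => [|j].
  by rewrite mulr_ge0 ?exprn_ge0 // subr_ge0 expr_le1.
pose c (k : nat) : C := if k is 0 then a 0 j else taylor_part F k z 0 j.
pose f (l : C) : C := F (l *: z) 0 j.
have lz (l : C) : `|l| < `|z|^-1 -> unit_ball X (l *: z).
  by move=> lz; rewrite /unit_ball /= normrZ -ltr_pdivlMr // mul1r.
have iz : 0 < `|z|^-1 by rewrite invr_gt0.
have f1 l : `|l| < `|z|^-1 -> `|f l| <= 1.
  by move=> /lz lB; apply: closure_polydisc_le1; exact: FD.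
have cf l : `|l| < `|z|^-1 ->
    (fun N => \sum_(0 <= k < N) c k * l ^+ k) @ \oo --> f l.
  move=> /lz lB; have cF := FT _ lB.
  have E N : \sum_(0 <= k < N.+1) c k * l ^+ k =
      (a + \sum_(1 <= k < N.+1) taylor_part F k (l *: z)) 0 j.
    rewrite mxE big_nat_recl //= expr0 mulr1 summxE big_add1 /=; congr (_ + _).
    apply: eq_bigr => k _; rewrite taylor_part_homogeneous mulrC.
    exact: esym (mxE _ _ _ _).
  have : (fun N => \sum_(0 <= k < N.+1) c k * l ^+ k) @ \oo --> f l.
    under eq_cvg do rewrite E.
    exact: (continuous_cvg _ (@coord_continuous C 1 n 0 j (F (l *: z))) cF).
  by rewrite (cvg_shiftS (fun N => \sum_(0 <= k < N) c k * l ^+ k)).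
have := bounded_power_series_coef geo iz f1 cf s0.
by case: s s0 => // s _; rewrite /= aE exprVn ler_pdivrMr ?exprn_gt0.
Qed.

Lemma bohr_mapping_taylor_le (R : realType) (X : normedModType R[i]) (n : nat)
    (a : 'rV[R[i]]_n) (F : X -> 'rV[R[i]]_n) (z : X) (s : nat) :
  (0 < n)%N -> bohr_mapping a F -> unit_ball X z -> (0 < s)%N ->
  `|taylor_part F s z| <= (1 - `|a| ^+ 2) * `|z| ^+ s.
Proof. exact: bohr_mapping_taylor_le_gen (@complex_geometric R). Qed.

(** * The extremal mapping *)

(** Both candidates approximate the same increment, so their difference is
    o(`|h|) while being homogeneous in its first argument h; scaling all the
    arguments into the unit ball makes the estimate available. *)
Lemma frechet_derivative_unique (K : numFieldType) (X Y : normedModType K) s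
    (G : X -> ('I_s -> X) -> Y) x A A' :
  is_frechet_derivative G x A -> is_frechet_derivative G x A' -> A = A'.
Proof.
move=> [lA _ dA] [lA' _ dA']; apply/funext => v.
pose c : K := (1 + \sum_i `|v i|)^-1.
have c0 : 0 < 1 + \sum_i `|v i|.
  by rewrite ltr_pwDl // sumr_ge0.
have c1 i : `|c *: v i| <= 1.
  rewrite normrZ gtr0_norm ?invr_gt0 // ler_pdivrMl // mulr1.
  by rewrite (bigD1 i) //= addrCA lerDl addr_ge0 // sumr_ge0.
have cs : c ^+ s.+1 != 0 by rewrite expf_neq0 // invr_eq0 gt_eqF.
apply: (scalerI cs); rewrite -!multilinear_scale //.
set u := fun i => c *: v i; apply/eqP; rewrite -subr_eq0 -normr_le0.
apply/ler_addgt0Pr => e e0; rewrite add0r.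
have e20 : 0 < e / 2 by rewrite divr_gt0.
have [d d0 Hd] := (nbhs_ballP _ _).1 (dA _ e20).
have [d' d'0 Hd'] := (nbhs_ballP _ _).1 (dA' _ e20).
(* a positive number below both d and d' *)
pose t : K := d * d' / (d + d').
have dd0 : 0 < d + d' by rewrite addr_gt0.
have t0 : 0 < t by rewrite divr_gt0 ?mulr_gt0.
have td : t < d by rewrite ltr_pdivrMr // ltr_pM2l // ltrDr.
have td' : t < d' by rewrite ltr_pdivrMr // mulrC ltr_pM2l // ltrDl.
pose h := t *: u ord0; pose w := fun i : 'I_s => u (lift ord0 i).
have ht : `|h| <= t by rewrite normrZ gtr0_norm // ler_piMr ?(ltW t0) ?c1.
have hB r : t < r -> ball 0 r h.
  by move=> tr; rewrite -ball_normE /= sub0r normrN (le_lt_trans ht).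
have wu : arg_cons h w = dfwith u ord0 h.
  apply/funext => i; rewrite /arg_cons; case: unliftP => [j|] -> /=.
    by rewrite dfwithout // eq_sym neq_lift.
  by rewrite dfwithin.
have w1 i : `|w i| <= 1 by exact: c1.
have {Hd} := Hd h (hB _ td) w w1; have {Hd'} := Hd' h (hB _ td') w w1.
have uu : dfwith u ord0 (u ord0) = u by apply/funext => i; case: dfwithP.
have sc B : multilinear_map B -> B (dfwith u ord0 h) = t *: B u :> Y.
  by move=> lB; rewrite (multilinear_scale1 u ord0 t (u ord0) lB) uu.
rewrite wu !sc //.
set P := G (x + h) w - G x w => HA' HA.
have : t * `|A u - A' u| <= t * e.
  rewrite -[t in leLHS](gtr0_norm t0) -normrZ.
  have -> : t *: (A u - A' u) = (P - t *: A' u) - (P - t *: A u).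
    by rewrite scalerBr opprB [RHS]addrC addrA subrK.
  apply: le_trans (ler_normB _ _) _; rewrite [e]splitr mulrDr.
  have th : e / 2 * `|h| <= t * (e / 2) by rewrite mulrC ler_pM2r.
  by apply: lerD; [apply: le_trans HA' _|apply: le_trans HA _].
by rewrite ler_pM2l.
Qed.

Lemma is_derive_bound (K : numFieldType) (f : K -> K) (w d e : K) :
  is_derive w 1 f d -> 0 < e ->
  \forall h \near (0 : K), `|f (w + h) - f w - d * h| <= e * `|h|.
Proof.
move=> [df <-] e0; have := df; rewrite /derivable => cf.
have /cvgrPdist_le /(_ e e0) : h^-1 *: ((f \o shift w) (h *: 1) - f w) @[h --> 0^'] -->
  'D_1 f w by [].
rewrite near_withinE; apply: filterS => h /= Hh.
have [->|h0] := eqVneq h 0.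
  by rewrite addr0 subrr mulr0 subr0 !normr0 mulr0.
have hn : 0 < `|h| by rewrite normr_gt0.
have := Hh h0; rewrite -(ler_pM2r hn) -normrM mulrBl /GRing.scale /= mulr1.
by rewrite mulrAC mulVf // mul1r distrC (addrC h).
Qed.

(** The s-th derivative of w |-> (al - w) / (1 - al w), written in partial
    fractions as al^-1 - (al^-1 - al) / (1 - al w) so that all the
    derivatives have the same shape. *)
Definition mobius_jet (K : numFieldType) (al : K) (s : nat) (w : K) : K :=
  (if s is 0 then al^-1 else 0) -
  (al^-1 - al) * s`!%:R * al ^+ s * ((1 - al * w) ^+ s.+1)^-1.

Lemma is_derive_mobius_jet (K : numFieldType) (al : K) (s : nat) (w : K) :
  1 - al * w != 0 ->
  is_derive w 1 (mobius_jet al s) (mobius_jet al s.+1 w).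
Proof.
move=> aw.
pose g := (fun u : K => 1 - al * u).
have dg : is_derive w 1 g (- al).
  have -> : g = cst 1 - al *: id by [].
  by apply: is_derive_eq; rewrite sub0r [_ *: _]mulr1.
have gn : (g ^+ s.+1) w != 0 by rewrite fctE expf_neq0.
have dgs := is_deriveX s.+1 dg.
have dgi : is_derive w 1 (fun u => ((g ^+ s.+1) u)^-1)
   (- ((g ^+ s.+1) w) ^- 2 *: ((s.+1%:R * g w ^+ s) *: (- al))).
  have [h1 h2] := dgs.
  apply: DeriveDef; first exact: derivableV.
  by rewrite deriveV // h2.
have -> : mobius_jet al s = cst (if s is 0 then al^-1 else 0) -
   ((al^-1 - al) * s`!%:R * al ^+ s) *: (fun u => ((g ^+ s.+1) u)^-1).
  by apply/funext => u; rewrite /mobius_jet !fctE /GRing.scale /=. 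
apply: is_derive_eq.
rewrite /mobius_jet /GRing.scale /= fctE factS natrM /g.
rewrite !exprS; set k := al^-1 - al.
by field; rewrite aw expf_neq0.
Qed.

Lemma mobius_jet_bound (K : numFieldType) (al : K) (s : nat) (w e : K) :
  1 - al * w != 0 -> 0 < e ->
  \forall h \near (0 : K), `|mobius_jet al s (w + h) - mobius_jet al s w -
    mobius_jet al s.+1 w * h| <= e * `|h|.
Proof. by move=> aw; apply: is_derive_bound; exact: is_derive_mobius_jet. Qed.

Section ExtremalMapping.
Variables (K : numFieldType) (X : normedModType K) (n : nat) (al : K).
Variable l : X -> K.
Hypotheses (n0 : (0 < n)%N) (al0 : 0 < al) (al1 : al < 1).
Hypothesis l_linear : forall c x y, l (c *: x + y) = c * l x + l y.
Hypothesis l_le : forall x, `|l x| <= `|x|.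

Let lD x y : l (x + y) = l x + l y.
Proof. by have := l_linear 1 x y; rewrite scale1r mul1r. Qed.

Lemma mobius_denom_neq0 (w : K) : `|w| < 1 -> 1 - al * w != 0.
Proof.
move=> w1; rewrite subr_eq0; apply/eqP => e.
have : `|al * w| < 1.
  rewrite normrM gtr0_norm // -(mulr1 1) ltr_pM //; exact: ltW.
by rewrite -e normr1 ltxx.
Qed.

Definition extremal_mapping (x : X) : 'rV[K]_n := const_mx (mobius_jet al 0 (l x)).

(** The induction runs over all the points of the open ball at once, as each
    derivative depends on the values of the previous one near x. The
    remainder is uniform in the arguments v because their product under l has
    modulus at most 1. *)
Lemma frechet_iter_extremal s x : `|x| < 1 ->
  frechet_iter extremal_mapping s x =
  fun v => const_mx (mobius_jet al s (l x) * \prod_i l (v i)).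
Proof.
elim: s x => [|s IH] x x1.
  by apply/funext => v /=; rewrite /extremal_mapping big_ord0 mulr1.
have lx1 : `|l x| < 1 by apply: le_lt_trans (l_le x) x1.
set A := fun v : 'I_s.+1 -> X => const_mx (mobius_jet al s.+1 (l x) * \prod_i l (v i)).
suff dA : is_frechet_derivative (@frechet_iter K X _ extremal_mapping s) x A.
  by apply: xget_unique => // B dB; exact: frechet_derivative_unique dB dA.
split.
- move=> v i c u w; apply/matrixP => j k; rewrite !mxE.
  rewrite !(bigD1 i (P := xpredT)) //= !dfwithin l_linear.
  have E y : \prod_(i0 < s.+1 | i0 != i) l (dfwith v i y i0) =
      \prod_(i0 < s.+1 | i0 != i) l (v i0).
    by apply: eq_bigr => i0 ii0; rewrite dfwithout // eq_sym.
  by rewrite !E; ring.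
- exists `|mobius_jet al s.+1 (l x)| => v v1.
  rewrite norm_const_mx // normrM ler_piMr // normr_prod.
  by apply: prodr_ile1 => i _; rewrite normr_ge0 (le_trans (l_le _)).
move=> e e0.
have [d d0 Hd] := (nbhs_ballP _ _).1 (mobius_jet_bound s (mobius_denom_neq0 lx1) e0).
have x10 : 0 < 1 - `|x| by rewrite subr_gt0.
near=> h => v v1.
have hd : `|h| < d by near: h; exact: nbhs0_lt.
have hx : `|h| < 1 - `|x| by near: h; exact: nbhs0_lt.
have xh1 : `|x + h| < 1.
  by apply: le_lt_trans (ler_normD _ _) _; rewrite addrC -ltrBrDr.
rewrite !IH // lD /A.
have -> : \prod_i l (arg_cons h v i) = l h * \prod_i l (v i).
  rewrite big_ord_recl /arg_cons unlift_none /=; congr (_ * _).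
  by apply: eq_bigr => i _; rewrite liftK.
set P := \prod_i l (v i).
have P1 : `|P| <= 1.
  rewrite normr_prod; apply: prodr_ile1 => i _.
  by rewrite normr_ge0 (le_trans (l_le _)).
have -> : const_mx (mobius_jet al s (l x + l h) * P) -
    const_mx (mobius_jet al s (l x) * P) -
    const_mx (mobius_jet al s.+1 (l x) * (l h * P)) =
  const_mx ((mobius_jet al s (l x + l h) - mobius_jet al s (l x) -
     mobius_jet al s.+1 (l x) * l h) * P) :> 'rV[K]_n.
  by apply/matrixP => i j; rewrite !mxE; ring.
rewrite norm_const_mx // normrM.
have lh : `|l h| <= `|h| by exact: l_le.
apply: (@le_trans _ _ (e * `|l h|)); last by rewrite ler_pM2l.
rewrite -[leRHS]mulr1; apply: ler_pM => //; apply: (Hd (l h)).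
by rewrite -ball_normE /= sub0r normrN (le_lt_trans lh).
Unshelve. all: by end_near. Qed.

Lemma taylor_part_extremal s z : (0 < s)%N ->
  taylor_part extremal_mapping s z =
  const_mx (- ((al^-1 - al) * (al * l z) ^+ s)).
Proof.
case: s => // s _; rewrite /taylor_part frechet_iter_extremal ?normr0 //.
have -> : l 0 = 0 by apply: (addrI (l 0)); rewrite -lD !addr0.
apply/matrixP => i j; rewrite !mxE prodr_const card_ord /mobius_jet.
rewrite mulr0 subr0 expr1n invr1 mulr1 sub0r exprMn.
have f0 : (s.+1)`!%:R != 0 :> K by rewrite pnatr_eq0 -lt0n fact_gt0.
by rewrite mulNr mulrN; congr (- _); set k := al^-1 - al; field.
Qed.

End ExtremalMapping.

(** The closed form from which the Taylor expansion of the extremal mapping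
    is summed. *)
Lemma geometric_partial_sum (K : fieldType) (q : K) N : 1 - q != 0 ->
  \sum_(1 <= s < N.+1) q ^+ s = (1 - q)^-1 - 1 - q ^+ N.+1 * (1 - q)^-1.
Proof.
move=> q1; elim: N => [|N IH]; first by rewrite big_geq // expr1; field.
by rewrite big_nat_recr //= IH !exprS; field.
Qed.

(** From `|1 - al w|^2 - `|al - w|^2 = (1 - al^2) (1 - `|w|^2). *)
Lemma norm_mobius_lt1 (C : numClosedFieldType) (al w : C) :
  0 < al -> al < 1 -> `|w| < 1 -> `|mobius_jet al 0 w| < 1.
Proof.
move=> al0 al1 w1; have aw := mobius_denom_neq0 al0 al1 w1.
have -> : mobius_jet al 0 w = (al - w) / (1 - al * w).
  by rewrite /mobius_jet fact0 expr0 expr1; field; rewrite aw gt_eqF.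
have aR : al^* = al by apply/CrealP; rewrite gtr0_real.
rewrite normrM normrV ?unitfE // ltr_pdivrMr ?normr_gt0 // mul1r.
rewrite -(@ltr_pXn2r _ 2) ?nnegrE // !normCK -subr_gt0.
rewrite !(rmorphB, rmorphM, rmorph1) /= aR.
have -> : (1 - al * w) * (1 - al * w^*) - (al - w) * (al - w^*) =
  (1 - al ^+ 2) * (1 - `|w| ^+ 2) by rewrite normCK; ring.
by rewrite mulr_gt0 // subr_gt0 expr_lt1 // ltW.
Qed.

Section ExtremalBohr.
Variables (C : numClosedFieldType) (X : normedModType C) (n : nat) (al : C).
Variable l : X -> C.
Hypothesis geo : forall q : C, `|q| < 1 -> (fun N => q ^+ N) @ \oo --> (0 : C).
Hypotheses (n0 : (0 < n)%N) (al0 : 0 < al) (al1 : al < 1).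
Hypothesis l_linear : forall c x y, l (c *: x + y) = c * l x + l y.
Hypothesis l_le : forall x, `|l x| <= `|x|.

Lemma differentiable_bounded_linear x : differentiable l x.
Proof.
have lin : linear (l : X -> C^o) by move=> c u v; exact: l_linear.
pose L : {linear X -> C^o} :=
  HB.pack (l : X -> C^o) (GRing.isLinear.Build C X C^o *:%R l lin).
apply: (@linear_differentiable C X C L) => y; apply/cvgrPdist_lt => e e0.
near=> u; rewrite -linearB /= (le_lt_trans (l_le _)) //.
Unshelve. all: by end_near. Qed.

Lemma extremal_bohr_mapping :
  bohr_mapping (const_mx al) (@extremal_mapping C X n al l).
Proof.
have polyF z : unit_ball X z -> polydisc C n (extremal_mapping n al l z).
  move=> zB j; rewrite mxE; apply: norm_mobius_lt1 => //.
  exact: le_lt_trans (l_le z) zB.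
split.
- by apply: subset_closure => j; rewrite mxE gtr0_norm.
- by move=> j; rewrite norm_const_mx // mxE.
- by move=> z zB; apply: subset_closure; exact: polyF.
- move=> z zB.
  have -> : @extremal_mapping C X n al l =
      (fun x => (mobius_jet al 0 \o l) x *: (const_mx 1 : 'rV[C]_n)).
    by apply/funext => x; apply/matrixP => i j; rewrite !mxE mulr1.
  apply: differentiableZl; apply: differentiable_comp.
    exact: differentiable_bounded_linear.
  apply/derivable1_diffP.
  have lz1 : `|l z| < 1 by apply: le_lt_trans (l_le z) zB.
  by have [] := is_derive_mobius_jet 0 (mobius_denom_neq0 al0 al1 lz1).
move=> z zB; have lz1 : `|l z| < 1 by apply: le_lt_trans (l_le z) zB.
have aw := mobius_denom_neq0 al0 al1 lz1.
pose q := al * l z; pose k := (al^-1 - al) * (1 - q)^-1.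
have q1 : `|q| < 1.
  rewrite normrM gtr0_norm // -(mulr1 1) ltr_pM //; exact: ltW.
have E N : const_mx al + \sum_(1 <= s < N.+1)
      taylor_part (extremal_mapping n al l) s z =
    extremal_mapping n al l z + q ^+ N.+1 *: const_mx k.
  rewrite big_nat; under eq_bigr => s /andP[s0 _] do rewrite taylor_part_extremal //.
  rewrite -big_nat; apply/matrixP => i j; rewrite !mxE summxE.
  under eq_bigr do rewrite mxE.
  rewrite sumrN -mulr_sumr geometric_partial_sum //.
  rewrite /mobius_jet fact0 expr0 expr1 /k -/q; set t := q ^+ N.+1.
  by field; rewrite aw gt_eqF.
under eq_cvg do rewrite E.
have cq : (fun N => q ^+ N.+1 *: (const_mx k : 'rV[C]_n)) @ \oo -->
    0 *: (const_mx k : 'rV[C]_n).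
  apply: cvgZ; last exact: cvg_cst.
  by rewrite (cvg_shiftS (fun N => q ^+ N)); exact: geo.
have cD : (fun N => extremal_mapping n al l z + q ^+ N.+1 *: const_mx k) @ \oo -->
    extremal_mapping n al l z + 0 *: const_mx k.
  by apply: cvgD cq; exact: cvg_cst.
by rewrite scale0r addr0 in cD.
Qed.

End ExtremalBohr.

(** * The Gamma function *)

Definition gamma_density (R : realType) (x t : R) : R :=
  t `^ (x - 1) * expR (- t).

Section GammaIntegral.
Variable R : realType.
Implicit Types (x t a b : R) (n : nat).
Local Notation mu := (@lebesgue_measure R).

Let exhaust n : set R := `[n.+1%:R^-1, n.+2%:R].

(** The chosen intervals exhaust the half-line and avoid the singularity of
    the density at 0, so that the fundamental theorem of calculus applies on
    each of them. *)
Definition gamma_trunc n x : R :=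
  \int[mu]_(t in `[n.+1%:R^-1, n.+2%:R]) gamma_density x t.

Lemma continuous_powR_gt0 p t : 0 < t -> {for t, continuous (fun u => u `^ p)}.
Proof.
move=> t0; apply: differentiable_continuous; apply/derivable1_diffP.
by apply: derivable_powR; rewrite in_itv /= t0.
Qed.

Lemma continuous_gamma_density x t : 0 < t ->
  {for t, continuous (gamma_density x)}.
Proof.
move=> t0; apply: continuousM; first exact: continuous_powR_gt0.
by apply: continuous_comp; [exact: opp_continuous|exact: continuous_expR].
Qed.

Lemma gamma_density_ge0 x t : 0 <= gamma_density x t.
Proof. by rewrite mulr_ge0 ?powR_ge0 ?expR_ge0. Qed.

Lemma within_continuous_gt0 (f : R -> R) a b : 0 < a ->
  (forall t, 0 < t -> {for t, continuous f}) ->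
  {within `[a, b], continuous f}.
Proof.
move=> a0 cf; apply: continuous_in_subspaceT => t.
by rewrite inE /= in_itv /= => /andP[at_ _]; apply: cf; apply: lt_le_trans at_.
Qed.

Lemma integrable_gamma_density x a b : 0 < a ->
  mu.-integrable `[a, b] (EFin \o gamma_density x).
Proof.
move=> a0; apply: continuous_compact_integrable; first exact: segment_compact.
by apply: within_continuous_gt0 a0 _ => t; exact: continuous_gamma_density.
Qed.

Lemma is_derive_expRN t : is_derive t 1 (fun u => - expR (- u)) (expR (- t)).
Proof.
have -> : (fun u => - expR (- u)) = - (@expR R \o -%R) by [].
by apply: is_derive_eq; rewrite mulrN1 opprK.
Qed.

Lemma gamma_density_by_parts x a b : 0 < a -> a < b ->
  \int[mu]_(t in `[a, b]) gamma_density (x + 1) t =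
  x * \int[mu]_(t in `[a, b]) gamma_density x t +
  (a `^ x * expR (- a) - b `^ x * expR (- b)).
Proof.
move=> a0 ab; have b0 := lt_trans a0 ab.
have pos t : t \in `]a, b[ -> 0 < t.
  by rewrite in_itv /= => /andP[at_ _]; exact: lt_trans at_.
have dF t : 0 < t -> is_derive t 1 (fun u => u `^ x) (x * t `^ (x - 1)).
  by move=> t0; exact: is_derive1_powR.
have LR (F : R -> R) : (forall t, 0 < t -> derivable F t 1) ->
    derivable_oo_LRcontinuous F a b.
  move=> dF'; have cF t : 0 < t -> {for t, continuous F}.
    by move=> t0; apply/differentiable_continuous/derivable1_diffP/dF'.
  split; first by move=> t /pos; exact: dF'.
  - by apply: cvg_at_right_filter; exact: cF.
  - by apply: cvg_at_left_filter; exact: cF.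
have := @Rintegration_by_parts R (fun t => t `^ x) (fun t => - expR (- t))
  (fun t => x * t `^ (x - 1)) (fun t => expR (- t)) a b ab.
have -> : \int[mu]_(t in `[a, b]) (t `^ x * expR (- t)) =
  \int[mu]_(t in `[a, b]) gamma_density (x + 1) t.
  by apply: eq_Rintegral => t _; rewrite /gamma_density addrK.
have -> : \int[mu]_(t in `[a, b]) (x * t `^ (x - 1) * - expR (- t)) =
    - x * \int[mu]_(t in `[a, b]) gamma_density x t.
  rewrite -RintegralZl //; last exact: integrable_gamma_density.
  by apply: eq_Rintegral => t _; rewrite /gamma_density mulrN mulNr mulrA.
move=> ->; last 6 first.
- apply: within_continuous_gt0 a0 _ => t t0.
  by apply: continuousM; [exact: cvg_cst|exact: continuous_powR_gt0].
- by apply: LR => t t0; have [] := dF t t0.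
- by move=> t /pos t0; rewrite derive1E; have [_ ->] := dF t t0.
- apply: within_continuous_gt0 a0 _ => t t0.
  by apply: continuous_comp; [exact: opp_continuous|exact: continuous_expR].
- by apply: LR => t t0; have [] := is_derive_expRN t.
- by move=> t _; rewrite derive1E; have [_ ->] := is_derive_expRN t.
ring.
Qed.

Lemma exhaust_bounds n : 0 < (n.+1%:R^-1 : R) /\ (n.+1%:R^-1 : R) < n.+2%:R.
Proof.
split; first by rewrite invr_gt0 ltr0n.
apply: (@le_lt_trans _ _ 1); first by rewrite invf_le1 ?ltr0n // ler1n.
by rewrite ltr1n.
Qed.

Lemma gamma_trunc_cvg x :
  (gamma_trunc n x)%:E @[n --> \oo] -->
  (\int[mu]_(t in `]0%R, +oo[) (gamma_density x t)%:E)%E.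
Proof.
have E : (fun n => (gamma_trunc n x)%:E) =
         (fun n => \int[mu]_(t in exhaust n) (gamma_density x t)%:E)%E.
  apply/funext => n; rewrite /gamma_trunc /Rintegral fineK //.
  apply: integrable_fin_num => //; apply: integrable_gamma_density.
  by have [] := exhaust_bounds n.
rewrite E; have -> : `]0, +oo[%classic = \bigcup_n exhaust n.
  apply/seteqP; split => t /=; last first.
    move=> [n _]; rewrite /exhaust /= !in_itv /= andbT => /andP[nt _].
    by apply: lt_le_trans nt; have [] := exhaust_bounds n.
  rewrite in_itv /= andbT => t0.
  pose n := maxn (Num.truncn t) (Num.truncn t^-1).
  exists n => //=; rewrite /exhaust /= in_itv /=; apply/andP; split.
    rewrite -[t]invrK lef_pV2 ?posrE ?ltr0n ?invr_gt0 //.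
    apply/ltW/(lt_le_trans (truncnS_gt _)); rewrite ler_nat ltnS.
    exact: leq_maxr.
  apply/ltW/(lt_le_trans (truncnS_gt _)); rewrite ler_nat ltnS.
  exact/leqW/leq_maxl.
apply: ge0_nondecreasing_set_cvg_integral.
- apply/nondecreasing_seqP => n; apply/subsetPset => t.
  rewrite /exhaust /= !in_itv /= => /andP[at_ tb]; apply/andP; split.
    by apply: le_trans at_; rewrite lef_pV2 ?posrE ?ltr0n // ler_nat.
  by apply: (le_trans tb); rewrite ler_nat.
- by move=> n; exact: measurable_itv.
- move=> n; have [n0 _] := exhaust_bounds n.
  by have /integrableP[] := integrable_gamma_density x n.+2%:R n0.
- by move=> n t _; rewrite lee_fin gamma_density_ge0.
Qed.

Let left_term n x : R := (n.+1%:R^-1) `^ x * expR (- n.+1%:R^-1).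
Let right_term n x : R := n.+2%:R `^ x * expR (- n.+2%:R).

Lemma left_term_le1 n x : 0 <= x -> 0 <= left_term n x <= 1.
Proof.
move=> x0; have [n0 _] := exhaust_bounds n.
rewrite mulr_ge0 ?powR_ge0 ?expR_ge0 //= mulr_ile1 ?powR_ge0 ?expR_ge0 //.
  apply: (@le_trans _ _ (1 `^ x)); last by rewrite powR1.
  apply: ge0_ler_powR; rewrite ?nnegrE ?ler01 ?(ltW n0) //.
  by rewrite invf_le1 ?ltr0n // ler1n.
Qed.

Lemma right_term_le x (m n : nat) : x <= m%:R ->
  0 <= right_term n x <= m.+1`!%:R / n.+1%:R.
Proof.
move=> xm; set b : R := n.+2%:R.
have b0 : 0 < b by rewrite ltr0n.
rewrite mulr_ge0 ?powR_ge0 ?expR_ge0 //=.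
have fm : 0 < m.+1`!%:R :> R by rewrite ltr0n fact_gt0.
apply: (@le_trans _ _ (m.+1`!%:R / b)); last first.
  by rewrite ler_pM2l // lef_pV2 ?posrE ?ltr0n // ler_nat.
apply: (@le_trans _ _ (b ^+ m * expR (- b))).
  rewrite ler_wpM2r ?expR_ge0 // -powR_mulrn ?(ltW b0) //.
  by apply: ler_powR => //; rewrite ler1n.
rewrite expRN ler_pdivrMr ?expR_gt0 // mulrAC ler_pdivlMr // -exprSr.
rewrite mulrC -ler_pdivrMr //; apply: le_trans (expR_ge1Dxn m (ltW b0)).
by rewrite lerDr.
Qed.

Lemma gamma_truncS n x :
  gamma_trunc n (x + 1) = x * gamma_trunc n x + (left_term n x - right_term n x).
Proof. by have [? ?] := exhaust_bounds n; exact: gamma_density_by_parts. Qed.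

(** At the integers the bound follows by induction from integration by parts,
    starting from the integral of the exponential. *)
Lemma gamma_trunc_nat_bounded (m : nat) :
  exists C, forall n, gamma_trunc n m.+1%:R <= C.
Proof.
elim: m => [|m [C HC]].
  exists 1 => n; rewrite -[1%:R]add0r gamma_truncS mul0r add0r.
  have /andP[_ l1] := left_term_le1 n (lexx 0).
  have /andP[r0 _] := @right_term_le 0 0 n (lexx _).
  by rewrite lerBlDr (le_trans l1) // lerDl.
exists (m.+1%:R * C + 1) => n.
rewrite -[m.+2]addn1 natrD gamma_truncS lerD //.
  by rewrite ler_wpM2l.
have /andP[_ l1] := @left_term_le1 n m.+1%:R (ler0n _ _).
have /andP[r0 _] := @right_term_le m.+1%:R m.+1 n (lexx _).
by rewrite lerBlDr (le_trans l1) // lerDl.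
Qed.

(** For arbitrary x > 0, t^x <= 1 + t^m with an integer m >= x bounds the
    integral with parameter x + 1, and integration by parts brings it back to
    x; this covers the singular range x < 1. *)
Lemma gamma_trunc_bounded x : 0 < x -> exists C, forall n, gamma_trunc n x <= C.
Proof.
move=> x0; pose m := (Num.truncn x).+1.
have xm : x <= m%:R by apply/ltW/truncnS_gt.
have [C1 HC1] := gamma_trunc_nat_bounded 0.
have [C2 HC2] := gamma_trunc_nat_bounded m.
exists ((C1 + C2 + m.+1`!%:R) / x) => n; rewrite ler_pdivlMr // mulrC.
have /andP[_ rn] := right_term_le n xm.
have /andP[l0 _] := left_term_le1 n (ltW x0).
have -> : x * gamma_trunc n x =
    gamma_trunc n (x + 1) - left_term n x + right_term n x.
  by rewrite gamma_truncS; ring.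
apply: lerD; last first.
  apply: (le_trans rn); rewrite ler_pdivrMr ?ltr0n // ler_peMr ?ler0n //.
  by rewrite ler1n.
rewrite lerBlDr (@le_trans _ _ (C1 + C2)) ?lerDl //.
apply: (@le_trans _ _ (gamma_trunc n 1 + gamma_trunc n m.+1%:R)); last exact: lerD.
have [n0 _] := exhaust_bounds n.
rewrite -RintegralD //; last 2 first.
- exact: integrable_gamma_density.
- exact: integrable_gamma_density.
apply: le_Rintegral => //.
- exact: integrable_gamma_density.
- apply: continuous_compact_integrable; first exact: segment_compact.
  apply: within_continuous_gt0 n0 _ => t t0.
  by apply: continuousD; exact: continuous_gamma_density.
move=> t /=; rewrite in_itv /= => /andP[nt _].
have t0 : 0 < t by exact: lt_le_trans nt.
rewrite /gamma_density -mulrDl ler_wpM2r ?expR_ge0 //.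
rewrite addrK subrr powRr0 -[m.+1]addn1 natrD addrK.
have [t1|/ltW t1] := lerP t 1.
  rewrite (@le_trans _ _ 1) ?lerDl ?powR_ge0 //.
  apply: (@le_trans _ _ (1 `^ x)); last by rewrite powR1.
  by apply: ge0_ler_powR; rewrite ?nnegrE ?(ltW x0) ?(ltW t0).
by rewrite (@le_trans _ _ (t `^ m%:R)) ?lerDr //; apply: ler_powR.
Qed.

Lemma GammaE x : Gamma x = fine (\int[mu]_(t in `]0%R, +oo[) (gamma_density x t)%:E)%E.
Proof. by []. Qed.

Lemma gamma_integral_fin_num x : 0 < x ->
  (\int[mu]_(t in `]0%R, +oo[) (gamma_density x t)%:E \is a fin_num)%E.
Proof.
move=> x0; have [C HC] := gamma_trunc_bounded x0.
rewrite ge0_fin_numE; last first.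
  by apply: integral_ge0 => t _; rewrite lee_fin gamma_density_ge0.
apply: (@le_lt_trans _ _ C%:E); last exact: ltry.
have cx := @gamma_trunc_cvg x; rewrite -(cvg_lim _ cx) //; apply: lime_le.
  exact: cvgP cx.
by apply: nearW => n; rewrite lee_fin.
Qed.

Lemma Gamma_cvg x : 0 < x -> gamma_trunc n x @[n --> \oo] --> Gamma x.
Proof.
move=> x0; rewrite GammaE; have := @gamma_trunc_cvg x.
by rewrite -(fineK (gamma_integral_fin_num x0)) => /fine_cvg.
Qed.

Lemma right_term_cvg0 x : right_term n x @[n --> \oo] --> 0.
Proof.
pose m := (Num.truncn x).+1.
have xm : x <= m%:R by apply/ltW/truncnS_gt.
apply: (@squeeze_cvgr _ _ _ _ (fun=> 0) (fun n => m.+1`!%:R / n.+1%:R)).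
- by apply: nearW => n; exact: right_term_le.
- exact: cvg_cst.
rewrite -[X in _ --> X](mulr0 (m.+1`!%:R : R)).
by apply: cvgMr; exact: cvg_harmonic.
Qed.

(** The boundary terms of the integration by parts over the truncated
    intervals vanish in the limit. *)
Lemma GammaS x : 0 < x -> Gamma (x + 1) = x * Gamma x.
Proof.
move=> x0; have l0 : left_term n x @[n --> \oo] --> 0.
  apply: (@squeeze_cvgr _ _ _ _ (fun=> 0) (fun n => n.+1%:R^-1 `^ x)).
  - apply: nearW => n; have [n0 _] := exhaust_bounds n.
    have /andP[-> _] := left_term_le1 n (ltW x0).
    by rewrite ler_piMr ?powR_ge0 // expR_le1 oppr_le0 ltW.
  - exact: cvg_cst.
  have /cvg_at_rightP := powR_cvg0 x0; apply; split.
    by move=> n; have [] := exhaust_bounds n.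
  exact: cvg_harmonic.
have r0 := @right_term_cvg0 x.
have S1 : gamma_trunc n (x + 1) @[n --> \oo] --> Gamma (x + 1).
  by apply: Gamma_cvg; rewrite addr_gt0.
have : gamma_trunc n (x + 1) @[n --> \oo] --> x * Gamma x + (0 - 0).
  under eq_cvg do rewrite gamma_truncS.
  apply: cvgD; last exact: cvgB.
  by apply: cvgMr; exact: Gamma_cvg.
by rewrite subr0 addr0 => /(cvg_unique _ S1); apply.
Qed.

Lemma Gamma1 : Gamma (1 : R) = 1.
Proof.
have c1 : gamma_trunc n 1 @[n --> \oo] --> Gamma (1 : R) by exact: Gamma_cvg.
suff : gamma_trunc n 1 @[n --> \oo] --> (1 : R) - 0.
  by rewrite subr0 => /(cvg_unique _ c1); apply.
have E n : gamma_trunc n 1 = left_term n 0 - right_term n 0.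
  by rewrite -[1]add0r gamma_truncS mul0r add0r.
under eq_cvg do rewrite E.
apply: cvgB; last exact: right_term_cvg0.
rewrite /left_term; under eq_cvg do rewrite powRr0 mul1r.
have : expR (- harmonic n) @[n --> \oo] --> expR (0 : R).
  apply: continuous_cvg; first exact: continuous_expR.
  by rewrite -[X in _ --> X]oppr0; apply: cvgN; exact: cvg_harmonic.
by rewrite expR0.
Qed.

(** On [1, 2] the density is at least expR (- 2) / 2. *)
Lemma Gamma_gt0 x : 0 < x -> 0 < Gamma x.
Proof.
move=> x0.
have low : expR (- 2) / 2 <= gamma_trunc 0 x.
  rewrite /gamma_trunc invr1.
  have -> : expR (- 2) / 2 = \int[mu]_(t in `[1, 2]) (expR (- 2) / 2).
    rewrite Rintegral_cst //= lebesgue_measure_itv /= lte_fin ltr1n /=.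
    by rewrite -[2]/(1 + 1) addrK mulr1.
  apply: le_Rintegral => //.
  - apply: continuous_compact_integrable; first exact: segment_compact.
    by apply: continuous_subspaceT => t; exact: cvg_cst.
  - exact: integrable_gamma_density.
  move=> t /=; rewrite in_itv /= => /andP[t1 t2].
  have t0 : 0 < t by exact: lt_le_trans t1.
  rewrite mulrC ler_pM ?invr_ge0 ?expR_ge0 //; last first.
    by rewrite ler_expR lerN2.
  apply: (@le_trans _ _ (t `^ (-1))).
    by rewrite powR_inv1 ?(ltW t0) // lef_pV2 ?posrE.
  by apply: ler_powR => //; rewrite -lerBlDr opprK addrC subrr ltW.
apply: (@lt_le_trans _ _ (expR (- 2) / 2)).
  by rewrite divr_gt0 ?expR_gt0.
apply: (le_trans low); rewrite -lee_fin GammaE.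
rewrite [leRHS](fineK (gamma_integral_fin_num x0)) /gamma_trunc invr1.
rewrite /Rintegral fineK; last first.
  by apply: integrable_fin_num => //; exact: integrable_gamma_density.
apply: ge0_subset_integral => //.
- apply/measurable_EFinP; apply: measurable_funM.
    by apply: measurable_funTS; exact: measurable_powR.
  by apply: measurableT_comp => //; exact: measurableT_comp.
- by move=> t _; rewrite lee_fin gamma_density_ge0.
- move=> t /=; rewrite !in_itv /= andbT => /andP[t1 _].
  exact: lt_le_trans t1.
Qed.

End GammaIntegral.

(** * Binomial series and Cesaro sums *)

(** The rising factorial of b over k!, that is, the k-th coefficient of (1 -
    x)^(- b). *)
Definition binomial_coef (R : realType) (b : R) (k : nat) : R :=
  (\prod_(i < k) (b + i%:R)) / k`!%:R.

Section BinomialSeries.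
Variable R : realType.
Implicit Types (b r : R) (k N : nat).

Lemma binomial_coef0 b : binomial_coef b 0 = 1.
Proof. by rewrite /binomial_coef big_ord0 fact0 divr1. Qed.

Lemma natS_neq0 k : (k.+1%:R : R) != 0. Proof. by rewrite pnatr_eq0. Qed.

Lemma fact_neq0 k : (k`!%:R : R) != 0.
Proof. by rewrite pnatr_eq0 -lt0n fact_gt0. Qed.

Lemma binomial_coefS b k :
  k.+1%:R * binomial_coef b k.+1 = (b + k%:R) * binomial_coef b k.
Proof.
rewrite /binomial_coef big_ord_recr /= factS natrM.
by field; rewrite fact_neq0 nat1r natS_neq0.
Qed.

Lemma binomial_coef_ge0 b k : 0 <= b -> 0 <= binomial_coef b k.
Proof.
by move=> b0; rewrite divr_ge0 ?ler0n // prodr_ge0 // => i _; rewrite addr_ge0.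
Qed.

Lemma binomial_coef_shift b k :
  k.+1%:R * binomial_coef b k.+1 = b * binomial_coef (b + 1) k.
Proof.
rewrite /binomial_coef big_ord_recl /= addr0 factS natrM.
have -> : \prod_(i < k) (b + (bump 0 i)%:R) = \prod_(i < k) (b + 1 + i%:R).
  by apply: eq_bigr => i _; rewrite /bump add1n -natr1 addrA addrAC.
by field; rewrite fact_neq0 nat1r natS_neq0.
Qed.

Lemma binomial_coef_pascal b k :
  binomial_coef b k.+1 - binomial_coef b k = binomial_coef (b - 1) k.+1.
Proof.
apply: (mulfI (natS_neq0 k)).
rewrite mulrBr binomial_coefS [RHS]binomial_coef_shift subrK -natr1; ring.
Qed.

Lemma binomial_coef_sum b N :
  \sum_(0 <= k < N.+1) binomial_coef b k = binomial_coef (b + 1) N.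
Proof.
elim: N => [|N IH]; first by rewrite big_nat1 !binomial_coef0.
rewrite big_nat_recr //= IH.
by have := binomial_coef_pascal (b + 1) N; rewrite addrK => <-; rewrite addrC subrK.
Qed.

Definition binomial_partial b N r : R :=
  \sum_(0 <= k < N) binomial_coef b k * r ^+ k.

Lemma is_derive_powR1B (p r : R) : r < 1 ->
  is_derive r 1 (fun u => (1 - u) `^ p) (- (p * (1 - r) `^ (p - 1))).
Proof.
move=> r1; have r10 : 0 < 1 - r by rewrite subr_gt0.
have dP := is_derive1_powR p r10.
have dB : is_derive r 1 (fun u : R => 1 - u) (-1).
  have -> : (fun u : R => 1 - u) = cst 1 - id by [].
  by apply: is_derive_eq; rewrite sub0r.
have := @is_derive1_comp R (fun v => v `^ p) (fun u => 1 - u) r _ _ dP dB.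
by move=> d; apply: is_derive_eq; rewrite mulrN1.
Qed.

(** The differential equation (1 - x) y' = b y of (1 - x)^(- b), with the
    defect caused by truncation. *)
Lemma is_derive_binomial_partial b N r : exists d,
  is_derive r 1 (binomial_partial b N) d /\
  (1 - r) * d - b * binomial_partial b N r =
    - (N%:R * binomial_coef b N * r ^+ N.-1).
Proof.
elim: N => [|N [d [dS E]]].
  exists 0; split; last by rewrite /binomial_partial big_nil !mulr0 !mul0r subr0 oppr0.
  have -> : binomial_partial b 0 = cst 0.
    by apply/funext => u; rewrite /binomial_partial big_nil.
  exact: is_derive_cst.
exists (d + binomial_coef b N * (N%:R * r ^+ N.-1)); split.
  have -> : binomial_partial b N.+1 =
      binomial_partial b N + (fun u => binomial_coef b N *: u ^+ N).
    by apply/funext => u; rewrite /binomial_partial big_nat_recr.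
  have -> : (fun u => binomial_coef b N *: u ^+ N) =
      binomial_coef b N *: (@GRing.exp R ^~ N) by [].
  apply: is_deriveD; apply: is_deriveZ.
  apply: DeriveDef; first exact: exprn_derivable.
  by rewrite exp_derive [LHS]mulr1.
rewrite [binomial_partial b N.+1 r]/binomial_partial big_nat_recr //=.
rewrite -/(binomial_partial b N r) binomial_coefS.
have rN : N%:R * r ^+ N = N%:R * (r * r ^+ N.-1).
  by case: N {dS E} => [|N]; rewrite ?mul0r // exprS.
set t := binomial_coef b N; set S := binomial_partial b N r.
have -> : (1 - r) * (d + t * (N%:R * r ^+ N.-1)) - b * (S + t * r ^+ N) =
    ((1 - r) * d - b * S) + t * (N%:R * r ^+ N.-1) -
    t * (N%:R * (r * r ^+ N.-1)) - b * t * r ^+ N by ring.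
by rewrite E -rN /t; ring.
Qed.

(** The product of the partial sum and (1 - u)^b has value 1 at u = 0, and
    its derivative is the truncation defect times (1 - u)^(b - 1). *)
Lemma binomial_partial_MVT b N r : 0 < r -> r < 1 -> exists2 c, 0 < c < r &
  1 - binomial_partial b N.+1 r * (1 - r) `^ b =
  r * ((1 - c) `^ (b - 1) * (N.+1%:R * binomial_coef b N.+1 * c ^+ N)).
Proof.
move=> r0 r1.
pose phi u := binomial_partial b N.+1 u * (1 - u) `^ b.
pose dphi u := - ((1 - u) `^ (b - 1) * (N.+1%:R * binomial_coef b N.+1 * u ^+ N)).
have dphiP (u : R) : u < 1 -> is_derive u 1 phi (dphi u).
  move=> u1; have [d [dS E]] := is_derive_binomial_partial b N.+1 u.
  have dW := is_derive_powR1B b u1.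
  have := is_deriveM dS dW => h; apply: is_derive_eq.
  have u10 : 1 - u != 0 by rewrite subr_eq0 gt_eqF.
  have -> : (1 - u) `^ b = (1 - u) * (1 - u) `^ (b - 1).
    rewrite -{2}[1 - u]powRr1 ?subr_ge0 ?(ltW u1) // -powRD; last by rewrite u10 implybT.
    by congr (_ `^ _); rewrite addrC subrK.
  move: E => /= /(congr1 -%R); rewrite opprK => E.
  rewrite /dphi -E /GRing.scale /=; ring.
have cphi : {within `[0, r], continuous phi}.
  apply: continuous_in_subspaceT => u; rewrite inE /= in_itv /= => /andP[_ ur].
  apply/differentiable_continuous/derivable1_diffP.
  by have [] := dphiP u (le_lt_trans ur r1).
have [c] := @MVT R phi dphi 0 r r0
  (fun u ur => dphiP u (lt_trans (proj2 (andP ur)) r1)) cphi.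
rewrite in_itv /= => cr; rewrite subr0 => Ec; exists c => //.
have phi0 : phi 0 = 1.
  rewrite /phi /binomial_partial subr0 powR1 mulr1 big_nat_recl //= binomial_coef0.
  by rewrite big1 ?addr0 ?mulr1 // => i _; rewrite expr0n mulr0.
have -> : 1 - binomial_partial b N.+1 r * (1 - r) `^ b = - (phi r - phi 0).
  by rewrite phi0 opprB.
rewrite Ec /dphi; ring.
Qed.

(** The defect has a sign, which bounds the partial sums of nonnegative terms
    and gives convergence before the value of the sum is known. *)
Lemma binomial_partial_le b N r : 0 <= b -> 0 < r -> r < 1 ->
  binomial_partial b N r <= (1 - r) `^ (- b).
Proof.
move=> b0 r0 r1; have w0 : 0 < (1 - r) `^ b by rewrite powR_gt0 // subr_gt0.
rewrite powRN -[leRHS]mul1r ler_pdivlMr //.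
case: N => [|N]; first by rewrite /binomial_partial big_nil mul0r.
have [c /andP[c0 cr] E] := binomial_partial_MVT b N r0 r1.
rewrite -subr_ge0 E mulr_ge0 ?(ltW r0) // mulr_ge0 ?powR_ge0 //.
by rewrite mulr_ge0 ?exprn_ge0 ?(ltW c0) // mulr_ge0 ?binomial_coef_ge0.
Qed.

Lemma binomial_terms_cvg0 b r : 0 <= b -> 0 < r -> r < 1 ->
  (fun k => binomial_coef b k * r ^+ k) @ \oo --> (0 : R).
Proof.
move=> b0 r0 r1; apply: cvg_series_cvg_0.
apply: nondecreasing_is_cvgn.
  apply/nondecreasing_seqP => n; rewrite /series /= big_nat_recr //= lerDl.
  by rewrite mulr_ge0 ?binomial_coef_ge0 ?exprn_ge0 ?(ltW r0).
exists ((1 - r) `^ (- b)) => _ [N _ <-]; exact: binomial_partial_le.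
Qed.

(** The defect at N is, up to bounded factors, a term of the binomial series
    with parameter b + 1, and so tends to 0. *)
Lemma binomial_series b r : 0 <= b -> 0 <= r -> r < 1 ->
  (fun N => binomial_partial b N r) @ \oo --> (1 - r) `^ (- b).
Proof.
move=> b0; rewrite le_eqVlt => /predU1P[<- _|r0 r1].
  rewrite subr0 powR1; apply: cvg_near_cst; exists 1%N => // -[//|N] _ /=.
  rewrite /binomial_partial big_nat_recl //= binomial_coef0.
  by rewrite big1 ?addr0 ?mulr1 // => i _; rewrite expr0n mulr0.
have w0 : 0 < (1 - r) `^ b by rewrite powR_gt0 // subr_gt0.
rewrite powRN -cvg_shiftS.
suff : (fun N => 1 - (1 - binomial_partial b N.+1 r * (1 - r) `^ b)) @ \oo --> (1 - 0 : R).
  move=> h; have : (fun N => (1 - (1 - binomial_partial b N.+1 r * (1 - r) `^ b)) *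
      ((1 - r) `^ b)^-1) @ \oo --> (1 - 0) * ((1 - r) `^ b)^-1.
    by apply: cvgM => //; exact: cvg_cst.
  rewrite subr0 mul1r; apply: cvg_trans; apply: near_eq_cvg; apply: nearW => N /=.
  by rewrite opprB addrC subrK mulfK // gt_eqF.
apply: cvgB; first exact: cvg_cst.
apply: (@squeeze_cvgr _ _ _ _ (fun=> 0)
  (fun N => (1 - r)^-1 * (b * r) * (binomial_coef (b + 1) N * r ^+ N))).
- apply: nearW => N; have [c /andP[c0 cr] E] := binomial_partial_MVT b N r0 r1.
  have c1 := lt_trans cr r1.
  rewrite E binomial_coef_shift; apply/andP; split.
    rewrite mulr_ge0 ?(ltW r0) // mulr_ge0 ?powR_ge0 //.
    rewrite mulr_ge0 ?exprn_ge0 ?(ltW c0) // mulr_ge0 //.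
    by rewrite binomial_coef_ge0 ?addr_ge0.
  have -> : r * ((1 - c) `^ (b - 1) * (b * binomial_coef (b + 1) N * c ^+ N)) =
    (1 - c) `^ (b - 1) * ((b * r) * (binomial_coef (b + 1) N * c ^+ N)) by ring.
  have b10 : 0 <= b + 1 by rewrite addr_ge0.
  rewrite -[leRHS]mulrA; apply: ler_pM.
  + exact: powR_ge0.
  + apply: mulr_ge0; first by rewrite mulr_ge0 ?(ltW r0).
    by rewrite mulr_ge0 ?binomial_coef_ge0 ?exprn_ge0 ?(ltW c0).
  + have c10 : 0 < 1 - c by rewrite subr_gt0.
    have c1b : (1 - c) `^ b <= 1.
      apply: (@le_trans _ _ (1 `^ b)); last by rewrite powR1.
      by apply: ge0_ler_powR; rewrite ?nnegrE ?(ltW c10) // gerBl ltW.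
    rewrite powRB; last by rewrite (gt_eqF c10) implybT.
    rewrite powRr1 ?(ltW c10) // -[leRHS]mul1r.
    apply: ler_pM => //; first exact: powR_ge0.
      by rewrite invr_ge0 ltW.
    by rewrite lef_pV2 ?posrE ?subr_gt0 // lerB // ltW.
  + rewrite ler_wpM2l ?mulr_ge0 ?(ltW r0) // ler_wpM2l ?binomial_coef_ge0 //.
    by rewrite lerXn2r ?nnegrE ?(ltW c0) ?(ltW r0) ?(ltW cr).
- exact: cvg_cst.
- rewrite -[X in _ --> X](mulr0 ((1 - r)^-1 * (b * r))).
  by apply: cvgMr; apply: binomial_terms_cvg0; rewrite ?addr_ge0.
Qed.

End BinomialSeries.

Section GammaRatios.
Variable R : realType.
Implicit Types (b r : R) (k N : nat).

Lemma Gamma_rising b k : 0 < b ->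
  Gamma (k%:R + b) = (\prod_(i < k) (b + i%:R)) * Gamma b.
Proof.
move=> b0; elim: k => [|k IH]; first by rewrite big_ord0 add0r mul1r.
rewrite big_ord_recr /= mulrAC -IH -natr1 addrAC GammaS; last first.
  by rewrite ltr_wpDl.
by rewrite mulrC (addrC b).
Qed.

Lemma Gamma_nat k : Gamma (k.+1%:R : R) = k`!%:R.
Proof.
elim: k => [|k IH]; first by rewrite Gamma1.
by rewrite -natr1 GammaS ?ltr0n // IH factS natrM.
Qed.

Lemma Gamma_ratio b k : 0 < b ->
  Gamma (k%:R + b) / (Gamma (k.+1%:R) * Gamma b) = binomial_coef b k.
Proof.
move=> b0; rewrite Gamma_rising // Gamma_nat /binomial_coef.
by field; rewrite fact_neq0 gt_eqF ?Gamma_gt0.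
Qed.

End GammaRatios.

(** The integral of (1 - x)^(- b) over [0, r]. *)
Definition cesaro_mass (R : realType) (b r : R) : R :=
  (1 - (1 - r) `^ (1 - b)) / (1 - b).

(** The integral of x (1 - x)^(- b - 1) over [0, r]. *)
Definition shifted_cesaro_mass (R : realType) (b r : R) : R :=
  ((1 - r) `^ (- b) - 1) / b - cesaro_mass b r.

Section CesaroSums.
Variables (R : realType) (b : R).
Hypotheses (b0 : 0 < b) (b1 : b != 1).
Implicit Types (r : R) (k N M : nat).

Let b1' : b - 1 != 0. Proof. by rewrite subr_eq0. Qed.
Let b1'' : 1 - b != 0. Proof. by rewrite subr_eq0 eq_sym. Qed.
Let bn0 : b != 0. Proof. by rewrite gt_eqF. Qed.

Definition cesaro_partial M r : R :=
  \sum_(0 <= k < M) binomial_coef b k / k.+1%:R * r ^+ k.+1.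

Definition shifted_cesaro_partial M r : R :=
  \sum_(0 <= N < M) (\sum_(0 <= k < N) binomial_coef b k) / N.+1%:R * r ^+ N.+1.

(** Term by term, binomial_coef b k / (k + 1) is the coefficient of index k +
    1 for the parameter b - 1, divided by b - 1; these coefficients are the
    differences of those for b. *)
Lemma cesaro_partialE M r : cesaro_partial M r =
  (binomial_partial b M.+1 r - r * binomial_partial b M r - 1) / (b - 1).
Proof.
elim: M => [|M IH].
  rewrite /cesaro_partial /binomial_partial !big_nil big_nat1 binomial_coef0.
  by rewrite mulr0 subr0 mul1r subrr mul0r.
rewrite /cesaro_partial big_nat_recr //= -/(cesaro_partial M r) IH.
rewrite [binomial_partial b M.+2 r]/binomial_partial big_nat_recr //=.
rewrite -/(binomial_partial b M.+1 r).
have -> : binomial_partial b M.+1 r =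
  binomial_partial b M r + binomial_coef b M * r ^+ M.
  by rewrite /binomial_partial big_nat_recr.
have e := binomial_coefS b M; have M0 := natS_neq0 R M.
have {e} -> : binomial_coef b M.+1 = (b + M%:R) / M.+1%:R * binomial_coef b M.
  by apply: (mulfI M0); rewrite e; field; rewrite nat1r M0.
rewrite -natr1 exprS in M0 *.
by field; rewrite M0 b1'.
Qed.

(** The inner sum telescopes to a coefficient for the parameter b + 1, which
    is a coefficient for b up to the factor (N + 1) / b. *)
Lemma shifted_cesaro_partialE M r : shifted_cesaro_partial M r =
  (binomial_partial b M.+1 r - 1) / b - cesaro_partial M r.
Proof.
elim: M => [|M IH].
  rewrite /shifted_cesaro_partial /cesaro_partial /binomial_partial !big_nil.
  by rewrite big_nat1 binomial_coef0 mul1r subrr mul0r subr0.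
rewrite /shifted_cesaro_partial big_nat_recr //= -/(shifted_cesaro_partial M r).
rewrite IH /cesaro_partial [in RHS]big_nat_recr //= -/(cesaro_partial M r).
rewrite [binomial_partial b M.+2 r]/binomial_partial big_nat_recr //=.
rewrite -/(binomial_partial b M.+1 r).
have M0 := natS_neq0 R M.
have -> : \sum_(0 <= k < M) binomial_coef b k =
    M.+1%:R * binomial_coef b M.+1 / b - binomial_coef b M.
  rewrite binomial_coef_shift -binomial_coef_sum big_nat_recr //=.
  by field.
by field; rewrite nat1r M0 bn0.
Qed.

Lemma cesaro_partial_cvg r : 0 <= r -> r < 1 ->
  (fun M => cesaro_partial M r) @ \oo --> cesaro_mass b r.
Proof.
move=> r0 r1; under eq_fun do rewrite cesaro_partialE.
have s := binomial_series (ltW b0) r0 r1.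
have s1 : (fun M => binomial_partial b M.+1 r) @ \oo --> (1 - r) `^ (- b).
  by rewrite (cvg_shiftS (fun M => binomial_partial b M r)).
have -> : cesaro_mass b r =
    ((1 - r) `^ (- b) - r * (1 - r) `^ (- b) - 1) / (b - 1).
  rewrite /cesaro_mass powRD; last by rewrite [1 - r == 0]subr_eq0 (gt_eqF r1) implybT.
  by rewrite powRr1 ?subr_ge0 ?(ltW r1) //; field; rewrite b1' b1''.
apply: cvgMl; apply: cvgB; last exact: cvg_cst.
by apply: cvgB => //; apply: cvgMr.
Qed.

Lemma shifted_cesaro_partial_cvg r : 0 <= r -> r < 1 ->
  (fun M => shifted_cesaro_partial M r) @ \oo --> shifted_cesaro_mass b r.
Proof.
move=> r0 r1; under eq_fun do rewrite shifted_cesaro_partialE.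
have s := binomial_series (ltW b0) r0 r1.
apply: cvgB; last exact: cesaro_partial_cvg.
apply: cvgMl; apply: cvgB; last exact: cvg_cst.
by rewrite (cvg_shiftS (fun M => binomial_partial b M r)).
Qed.

Lemma shifted_cesaro_mass_ge0 r : 0 <= r -> r < 1 ->
  0 <= shifted_cesaro_mass b r.
Proof.
move=> r0 r1; have c := shifted_cesaro_partial_cvg r0 r1.
rewrite -(cvg_lim _ c) //; apply: limr_ge; first exact: cvgP c.
apply: nearW => M; apply: sumr_ge0 => N _.
rewrite mulr_ge0 ?exprn_ge0 // divr_ge0 // sumr_ge0 // => k _.
by rewrite binomial_coef_ge0 // ltW.
Qed.

Lemma cesaro_mass_ge0 r : 0 <= r -> r < 1 -> 0 <= cesaro_mass b r.
Proof.
move=> r0 r1; have c := cesaro_partial_cvg r0 r1.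
rewrite -(cvg_lim _ c) //; apply: limr_ge; first exact: cvgP c.
apply: nearW => M; apply: sumr_ge0 => k _.
by rewrite mulr_ge0 ?exprn_ge0 // divr_ge0 // binomial_coef_ge0 // ltW.
Qed.

(** In the notation of the introduction, A - 2 (B - A) = 3 A - 2 B. *)
Definition bohr_gap r : R := cesaro_mass b r - 2 * shifted_cesaro_mass b r.

Lemma bohr_gap_radius r : radius_equation b r <-> bohr_gap r = 0.
Proof.
suff -> : bohr_gap r = 3 * (1 - (1 - r) `^ (1 - b)) / (1 - b)
    - 2 * ((1 - r) `^ (- b) - 1) / b by [].
by rewrite /bohr_gap /shifted_cesaro_mass /cesaro_mass; field; rewrite b1'' bn0.
Qed.

Lemma is_derive_bohr_gap r : r < 1 ->
  is_derive r 1 bohr_gap ((1 - r) `^ (- b - 1) * (1 - 3 * r)).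
Proof.
move=> r1; have r10 : 1 - r != 0 by rewrite subr_eq0 gt_eqF.
have d1 := is_derive_powR1B (1 - b) r1.
have d2 := is_derive_powR1B (- b) r1.
pose f1 := (fun u : R => (1 - u) `^ (1 - b)).
pose f2 := (fun u : R => (1 - u) `^ (- b)).
have -> : bohr_gap = (3 / (1 - b)) *: (cst 1 - f1) - (2 / b) *: (f2 - cst 1).
  apply/funext => u; rewrite /bohr_gap /shifted_cesaro_mass /cesaro_mass.
  by rewrite !fctE /GRing.scale /= /f1 /f2; field; rewrite b1'' bn0.
have D := is_deriveB
  (is_deriveZ (3 / (1 - b)) (is_deriveB (is_derive_cst (1 : R) r 1) d1))
  (is_deriveZ (2 / b) (is_deriveB d2 (is_derive_cst (1 : R) r 1))).
apply: (is_derive_eq D).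
have -> : (1 - r) `^ (1 - b - 1) = (1 - r) * (1 - r) `^ (- b - 1).
  rewrite -{2}[1 - r]powRr1 ?subr_ge0 ?(ltW r1) // -powRD; last by rewrite r10 implybT.
  by congr (_ `^ _); ring.
by rewrite /GRing.scale /=; field; rewrite b1'' bn0.
Qed.

(** The function vanishes at 0, increases up to 1/3 and decreases afterwards,
    so its zero in ]0, 1[ lies beyond 1/3 and is the only sign change. *)
Lemma bohr_gap_sign (rho : R) : 0 < rho -> rho < 1 -> bohr_gap rho = 0 ->
  (forall r, 0 <= r -> r <= rho -> 0 <= bohr_gap r) /\
  (forall r, rho < r -> r < 1 -> bohr_gap r < 0).
Proof.
move=> rho0 rho1 grho.
have t0 : 0 < 3^-1 :> R by rewrite invr_gt0.
have t1 : 3^-1 < 1 :> R by rewrite invf_lt1 // ltr1n.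
have g0 : bohr_gap 0 = 0.
  by rewrite /bohr_gap /shifted_cesaro_mass /cesaro_mass subr0 !powR1; ring.
have cont a c : c < 1 -> {within `[a, c], continuous bohr_gap}.
  move=> c1; apply: continuous_in_subspaceT => u; rewrite inE /= in_itv /= => /andP[_ uc].
  apply/differentiable_continuous/derivable1_diffP.
  by have [] := is_derive_bohr_gap (le_lt_trans uc c1).
have der u : u < 1 -> derivable bohr_gap u 1.
  by move=> u1; have [] := is_derive_bohr_gap u1.
have derE u : u < 1 -> derive1 bohr_gap u = (1 - u) `^ (- b - 1) * (1 - 3 * u).
  by move=> u1; rewrite derive1E; have [_] := is_derive_bohr_gap u1.
have pw u : u < 1 -> 0 < (1 - u) `^ (- b - 1) by move=> u1; rewrite powR_gt0 ?subr_gt0.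
have incr x y : 0 <= x -> x < y -> y <= 3^-1 -> bohr_gap x < bohr_gap y.
  apply: (@gtr0_derive1_incr _ _ 0 3^-1); last exact: cont.
  - by move=> u; rewrite in_itv /= => /andP[_ u3]; apply/der/(lt_trans u3).
  - move=> u; rewrite in_itv /= => /andP[_ u3]; have u1 := lt_trans u3 t1.
    by rewrite derE // mulr_gt0 ?pw // subr_gt0 mulrC -ltr_pdivlMr // mul1r.
have decr x y : 3^-1 <= x -> x < y -> y < 1 -> bohr_gap y < bohr_gap x.
  move=> x3 xy y1; apply: (@ltr0_derive1_decr _ _ 3^-1 y) => //; last exact: cont.
  - by move=> u; rewrite in_itv /= => /andP[_ uy]; apply/der/(lt_trans uy).
  - move=> u; rewrite in_itv /= => /andP[u3 uy]; have u1 := lt_trans uy y1.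
    by rewrite derE // pmulr_rlt0 ?pw // subr_lt0 mulrC -ltr_pdivrMr // mul1r.
have rho3 : 3^-1 < rho.
  rewrite ltNge; apply/negP => rho3.
  by have := incr _ _ (lexx 0) rho0 rho3; rewrite g0 grho ltxx.
split=> r.
  move=> r0 rrho; have [r3|r3] := lerP r 3^-1.
    move: r0; rewrite le_eqVlt => /predU1P[<-|r0]; first by rewrite g0.
    by rewrite -g0 ltW // incr.
  move: rrho; rewrite le_eqVlt => /predU1P[->|rrho]; first by rewrite grho.
  by rewrite -grho ltW // decr // ltW.
by move=> rhor r1; rewrite -grho decr // ltW.
Qed.

End CesaroSums.

(** * The majorant series *)

Section MajorantSeries.
Variables (R : realType) (b : R).
Hypotheses (b0 : 0 < b) (b1 : b != 1).

Lemma nneseries_cvg_eq (u : nat -> R) m (s : R) :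
  (fun M => \sum_(m <= k < M) u k) @ \oo --> s ->
  (\sum_(m <= k <oo) (u k)%:E = s%:E)%E.
Proof.
move=> us; apply/cvg_lim => //.
have -> : (fun M => \sum_(m <= k < M) (u k)%:E)%E =
    EFin \o (fun M => \sum_(m <= k < M) u k).
  by apply/funext => M; rewrite /= sumEFin.
by apply/cvg_EFin; [exact: nearW|].
Qed.

Lemma nneseries_le (u : nat -> R) m (s : R) : (forall k, 0 <= u k) ->
  (forall M, \sum_(m <= k < M) u k <= s) ->
  (\sum_(m <= k <oo) (u k)%:E <= s%:E)%E.
Proof.
move=> u0 us; apply: lime_le; first by apply: is_cvg_nneseries => k _; rewrite lee_fin.
by apply: nearW => M; rewrite sumEFin lee_fin.
Qed.

Lemma nneseries_ge (u : nat -> R) m M : (forall k, 0 <= u k) ->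
  ((\sum_(m <= k < M) u k)%:E <= \sum_(m <= k <oo) (u k)%:E)%E.
Proof.
move=> u0; rewrite -sumEFin; apply: nneseries_lim_ge => k _.
by rewrite lee_fin.
Qed.

Variables (X : normedModType R[i]) (n : nat).
Implicit Types (a : 'rV[R[i]]_n) (F : X -> 'rV[R[i]]_n) (z : X).

(** The N-th term of the second series, with the Gamma quotients evaluated
    and the inner index starting at 0. *)
Definition tail_term F z (N : nat) : R :=
  N.+1%:R^-1 * \sum_(0 <= k < N)
    binomial_coef b k * rnorm z ^+ k * rnorm (taylor_part F (N - k) z).

Lemma tail_term_ge0 F z N : 0 <= tail_term F z N.
Proof.
rewrite mulr_ge0 ?invr_ge0 // sumr_ge0 // => k _.
rewrite mulr_ge0 ?rnorm_ge0 // mulr_ge0 ?exprn_ge0 ?rnorm_ge0 //.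
by rewrite binomial_coef_ge0 // ltW.
Qed.

Lemma cesaro_majorantE a F z : cesaro_majorant b a F z =
  (\sum_(0 <= k <oo)
      (rnorm a * (binomial_coef b k / k.+1%:R * rnorm z ^+ k))%:E +
   \sum_(1 <= N <oo) (tail_term F z N)%:E)%E.
Proof.
rewrite /cesaro_majorant; congr (_ + _)%E.
  apply: eq_eseriesr => k _; congr EFin.
  rewrite -natrD addn2 Gamma_rising // Gamma_nat /binomial_coef factS natrM.
  by field; rewrite nat1r natS_neq0 fact_neq0 gt_eqF ?Gamma_gt0.
apply: eq_eseriesr => N _; congr EFin; rewrite /tail_term; congr (_ * _).
rewrite big_add1 /=; apply: eq_big_nat => k /andP[_ kN].
by rewrite -natr1 addrK subn1 /= natr1 Gamma_ratio // addn1 -subSn.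
Qed.

Lemma head_series a r : 0 < r -> r < 1 ->
  (\sum_(0 <= k <oo) (rnorm a * (binomial_coef b k / k.+1%:R * r ^+ k))%:E =
   (rnorm a * (r^-1 * cesaro_mass b r))%:E)%E.
Proof.
move=> r0 r1; apply: nneseries_cvg_eq.
have -> : (fun M => \sum_(0 <= k < M) rnorm a * (binomial_coef b k / k.+1%:R * r ^+ k))
   = (fun M => rnorm a * (r^-1 * cesaro_partial b M r)).
  apply/funext => M; rewrite /cesaro_partial !mulr_sumr; apply: eq_bigr => k _.
  by rewrite exprS; field; rewrite nat1r natS_neq0 gt_eqF.
by apply: cvgMr; apply: cvgMr; apply: cesaro_partial_cvg => //; exact: ltW.
Qed.

Lemma rnorm_taylor_le a F z s : (0 < n)%N -> bohr_mapping a F ->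
  unit_ball X z -> (0 < s)%N ->
  rnorm (taylor_part F s z) <= (1 - rnorm a ^+ 2) * rnorm z ^+ s.
Proof.
move=> n0 bF zB s0; have := bohr_mapping_taylor_le n0 bF zB s0.
by rewrite !rnormE -!rmorphXn -[1]/(1%:C) -rmorphB -rmorphM /= lecR.
Qed.

Lemma tail_term_le a F z N : (0 < n)%N -> bohr_mapping a F ->
  unit_ball X z ->
  tail_term F z N <= (1 - rnorm a ^+ 2) *
     ((\sum_(0 <= k < N) binomial_coef b k) / N.+1%:R * rnorm z ^+ N).
Proof.
move=> n0 bF zB.
have -> : (1 - rnorm a ^+ 2) *
     ((\sum_(0 <= k < N) binomial_coef b k) / N.+1%:R * rnorm z ^+ N) =
   N.+1%:R^-1 * \sum_(0 <= k < N)
     binomial_coef b k * ((1 - rnorm a ^+ 2) * rnorm z ^+ N).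
  by rewrite -mulr_suml; ring.
rewrite ler_wpM2l ?invr_ge0 // !big_nat; apply: ler_sum => k /andP[_ kN].
rewrite -mulrA ler_wpM2l ?binomial_coef_ge0 ?(ltW b0) //.
have -> : rnorm z ^+ N = rnorm z ^+ k * rnorm z ^+ (N - k).
  by rewrite -exprD subnKC // ltnW.
rewrite mulrCA ler_wpM2l ?exprn_ge0 ?rnorm_ge0 //.
by rewrite rnorm_taylor_le // subn_gt0.
Qed.

Lemma bohr_mapping_rnorm_le1 a F : (0 < n)%N -> bohr_mapping a F -> rnorm a <= 1.
Proof.
move=> n0 [clA aE _ _ _]; rewrite -lecR -rnormE -(aE (Ordinal n0)).
exact: closure_polydisc_le1.
Qed.

(** At r = 0 only the constant term `|a| of the first series survives. *)
Lemma cesaro_majorant_le a F z : (0 < n)%N -> bohr_mapping a F ->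
  unit_ball X z -> 0 <= bohr_gap b (rnorm z) ->
  (cesaro_majorant b a F z <= (cesaro_bound b (rnorm z))%:E)%E.
Proof.
move=> n0 bF zB gap; have a1 := bohr_mapping_rnorm_le1 n0 bF.
have a0 := rnorm_ge0 a; have r0 := rnorm_ge0 z; set r := rnorm z in gap r0 *.
have r1 : r < 1 by rewrite -ltcR -rnormE.
have aa : 0 <= 1 - rnorm a ^+ 2 by rewrite subr_ge0 expr_le1.
have tle N : tail_term F z N <= _ := tail_term_le N n0 bF zB.
rewrite cesaro_majorantE -/r /cesaro_bound.
have [rz|rn0] := eqVneq r 0.
  rewrite rz -[leRHS]adde0; apply: leeD.
    apply: nneseries_le => [k|M].
      rewrite mulr_ge0 // mulr_ge0 ?exprn_ge0 // divr_ge0 //.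
      by rewrite binomial_coef_ge0 // ltW.
    case: M => [|M]; first by rewrite big_nil.
    rewrite big_nat_recl //= binomial_coef0 expr0 divr1 !mulr1 big1 ?addr0 // => k _.
    by rewrite expr0n mulr0 mulr0.
  apply: nneseries_le => [N|M]; first exact: tail_term_ge0.
  rewrite big_nat; apply: sumr_le0 => N /andP[N0 _]; apply: (le_trans (tle N)).
  by rewrite -/r rz expr0n (gtn_eqF N0) !mulr0.
have rp : 0 < r by rewrite lt_def rn0.
rewrite (head_series _ rp r1).
set A := cesaro_mass b r; set B := shifted_cesaro_mass b r.
have B0 : 0 <= B by exact: shifted_cesaro_mass_ge0.
have H2 : (\sum_(1 <= N <oo) (tail_term F z N)%:E <=
    ((1 - rnorm a ^+ 2) * (r^-1 * B))%:E)%E.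
  apply: nneseries_le => [N|M]; first exact: tail_term_ge0.
  apply: (@le_trans _ _ (\sum_(1 <= N < M) (1 - rnorm a ^+ 2) *
     ((\sum_(0 <= k < N) binomial_coef b k) / N.+1%:R * r ^+ N))).
    by apply: ler_sum => N _; exact: tle.
  rewrite -mulr_sumr ler_wpM2l // ler_pdivlMl // mulr_sumr.
  have c := shifted_cesaro_partial_cvg b0 b1 r0 r1.
  apply: (@le_trans _ _ (shifted_cesaro_partial b M r)).
    rewrite /shifted_cesaro_partial.
    case: M => [|M]; first by rewrite !big_geq.
    rewrite [leRHS]big_ltn // [\sum_(0 <= _ < 0) _]big_geq // !mul0r add0r.
    by apply: ler_sum => N _; rewrite exprS mulrCA.
  rewrite /B -(cvg_lim _ c) //; apply: (nondecreasing_cvgn_le _ (cvgP _ c)).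
  apply/nondecreasing_seqP => N.
  rewrite /shifted_cesaro_partial [leRHS]big_nat_recr //= lerDl.
  rewrite mulr_ge0 ?exprn_ge0 // divr_ge0 // sumr_ge0 // => k _.
  by rewrite binomial_coef_ge0 // ltW.
apply: (le_trans (leeD (lexx _) H2)).
rewrite -EFinD lee_fin -[r^-1 * (_ / _)]/(r^-1 * A).
have -> : rnorm a * (r^-1 * A) + (1 - rnorm a ^+ 2) * (r^-1 * B) =
   r^-1 * (rnorm a * A + (1 - rnorm a ^+ 2) * B) by ring.
rewrite ler_pM2l ?invr_gt0 // -subr_ge0.
have -> : A - (rnorm a * A + (1 - rnorm a ^+ 2) * B) =
  (1 - rnorm a) * ((A - 2 * B) + (1 - rnorm a) * B) by ring.
by rewrite mulr_ge0 ?subr_ge0 // addr_ge0 // mulr_ge0 // subr_ge0.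
Qed.

End MajorantSeries.

Section Sharpness.
Variables (R : realType) (b : R).
Hypotheses (b0 : 0 < b) (b1 : b != 1).

(** The condition holds at al = 1 for large M, since the partial sums
    converge to shifted_cesaro_mass b r > cesaro_mass b r / 2, and it is open
    in al. *)
Lemma sharp_parameter (r : R) : 0 < r -> r < 1 -> bohr_gap b r < 0 ->
  exists (M : nat) (al : R), [/\ 0 < al, al < 1 &
    cesaro_mass b r < (1 + al) * al ^+ M * shifted_cesaro_partial b M.+1 r].
Proof.
move=> r0 r1; rewrite /bohr_gap subr_lt0 => gap.
have c := shifted_cesaro_partial_cvg b0 b1 (ltW r0) r1.
have {c}[M _ HM] : \forall M \near \oo,
    cesaro_mass b r / 2 < shifted_cesaro_partial b M r.
  by apply: (cvgr_gt _ c); rewrite ltr_pdivrMr // mulrC.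
have {HM} := HM M.+1 (leqnSn M); set V := shifted_cesaro_partial b M.+1 r.
rewrite ltr_pdivrMr // mulrC => AV.
exists M; pose phi (x : R) := (1 + x) * x ^+ M * V.
have cphi : phi x @[x --> 1^'-] --> phi 1.
  apply: cvg_at_left_filter; apply: cvgMl; apply: cvgM.
    by apply: cvgD; [exact: cvg_cst|exact: cvg_id].
  exact: exprn_continuous.
have : \forall x \near 1^'-, cesaro_mass b r < phi x.
  by apply: (cvgr_gt _ cphi); rewrite /phi expr1n mulr1 -[1 + 1]/2.
move=> nphi; near (1 : R)^'- => al; exists al; split.
- by near: al; exact: nbhs_left_gt.
- by near: al; exact: nbhs_left_lt.
- by near: al.
Unshelve. all: by end_near. Qed.

(** In the terms of index N <= M of the second series the powers of al are at
    least al^M, which leaves a multiple of the partial sum of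
    sharp_parameter. *)
Lemma bohr_radius_sharp (X : normedModType R[i]) (n : nat) (r : R) :
  (exists x : X, x != 0) -> (0 < n)%N -> 0 < r -> r < 1 -> bohr_gap b r < 0 ->
  exists (a : 'rV[R[i]]_n) (F : X -> 'rV[R[i]]_n) (z : X),
    [/\ bohr_mapping a F, unit_ball X z, rnorm z = r &
        ~ (cesaro_majorant b a F z <= (cesaro_bound b (rnorm z))%:E)%E].
Proof.
move=> [x x0] n0 r0 r1 gap.
have nx0 : rnorm x != 0.
  by apply: contra x0 => /eqP nx; rewrite -normr_eq0 rnormE nx.
pose z := (r / rnorm x)%:C *: x.
have zr : rnorm z = r.
  by rewrite rnormZ ger0_norm ?divr_ge0 ?rnorm_ge0 ?(ltW r0) // mulfVK.
have zB : unit_ball X z by rewrite /unit_ball /= rnormE zr -[1]/(1%:C) ltcR.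
have [M [al [al0 al1 gapM]]] := sharp_parameter r0 r1 gap.
have [l [ll lle lz]] := hahn_banach_norming z.
have alc0 : 0 < al%:C by rewrite -[0]/(0%:C) ltcR.
have alc1 : al%:C < 1 by rewrite -[1]/(1%:C) ltcR.
exists (const_mx al%:C), (extremal_mapping n al%:C l), z.
have bF := extremal_bohr_mapping (@complex_geometric R) n0 alc0 alc1 ll lle.
split => //.
apply/negP; rewrite -ltNge zr cesaro_majorantE // zr.
have ra : rnorm (const_mx al%:C : 'rV[R[i]]_n) = al.
  by rewrite /rnorm norm_const_mx // gtr0_norm.
rewrite head_series // ra /cesaro_bound (gt_eqF r0).
rewrite -[r^-1 * (_ / _)]/(r^-1 * cesaro_mass b r).
set A := cesaro_mass b r in gapM *.
pose k := al^-1 - al.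
have k0 : 0 < k by rewrite subr_gt0 (lt_trans al1) // invf_gt1.
have tp s : (0 < s)%N ->
    rnorm (taylor_part (extremal_mapping n al%:C l) s z) = k * (al * r) ^+ s.
  move=> s0; rewrite taylor_part_extremal // lz rnormE zr.
  have -> : ((al%:C)^-1 - al%:C) * (al%:C * r%:C) ^+ s = (k * (al * r) ^+ s)%:C.
    by rewrite !(rmorphM, rmorphXn, rmorphB, fmorphV).
  rewrite /rnorm norm_const_mx // normrN ger0_norm // ler0c.
  by rewrite mulr_ge0 ?exprn_ge0 ?mulr_ge0 ?(ltW k0) ?(ltW al0) ?(ltW r0).
have tail N : (N <= M)%N -> k * al ^+ M / r *
     ((\sum_(0 <= i < N) binomial_coef b i) / N.+1%:R * r ^+ N.+1) <=
    tail_term b (extremal_mapping n al%:C l) z N.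
  move=> NM; rewrite /tail_term zr.
  have -> : k * al ^+ M / r *
     ((\sum_(0 <= i < N) binomial_coef b i) / N.+1%:R * r ^+ N.+1) =
     N.+1%:R^-1 * \sum_(0 <= i < N) binomial_coef b i * (k * al ^+ M * r ^+ N).
    by rewrite -mulr_suml exprS; field; rewrite nat1r natS_neq0 gt_eqF.
  rewrite ler_wpM2l ?invr_ge0 // !big_nat; apply: ler_sum => i /andP[_ iN].
  rewrite tp ?subn_gt0 // -[leRHS]mulrA ler_wpM2l ?binomial_coef_ge0 ?(ltW b0) //.
  have -> : r ^+ N = r ^+ i * r ^+ (N - i) by rewrite -exprD subnKC // ltnW.
  rewrite exprMn.
  have -> : r ^+ i * (k * (al ^+ (N - i) * r ^+ (N - i))) =
    k * al ^+ (N - i) * (r ^+ i * r ^+ (N - i)) by ring.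
  rewrite ler_wpM2r ?mulr_ge0 ?exprn_ge0 ?(ltW r0) // ler_wpM2l ?(ltW k0) //.
  by rewrite ler_wiXn2l ?(ltW al0) ?(ltW al1) // (leq_trans (leq_subr _ _)).
set V := shifted_cesaro_partial b M.+1 r in gapM.
have H2 : ((k * al ^+ M / r * V)%:E <=
    \sum_(1 <= N <oo) (tail_term b (extremal_mapping n al%:C l) z N)%:E)%E.
  apply: le_trans (nneseries_ge 1 M.+1 (tail_term_ge0 b0 _ z)).
  rewrite lee_fin /V /shifted_cesaro_partial big_ltn // [\sum_(0 <= _ < 0) _]big_geq //.
  rewrite !mul0r add0r mulr_sumr !big_nat; apply: ler_sum => N /andP[_ NM].
  exact: tail.
apply: (lt_le_trans _ (leeD (lexx _) H2)).
rewrite -EFinD lte_fin -subr_gt0.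
have -> : al * (r^-1 * A) + k * al ^+ M / r * V - r^-1 * A =
   (1 - al) / r * ((1 + al) * al ^+ M * V / al - A).
  by rewrite /k; field; rewrite !gt_eqF.
rewrite mulr_gt0 ?divr_gt0 ?subr_gt0 // ltr_pdivlMr // (le_lt_trans _ gapM) //.
by rewrite ler_piMr ?(ltW al1) // cesaro_mass_ge0 // ltW.
Qed.

End Sharpness.

Unset Implicit Arguments.

Theorem theorem2p4 (R : realType) (X : completeNormedModType R[i])
    (X_neq0 : exists x : X, x != 0) (n : nat) (n_ge1 : (1 <= n)%N)
    (beta : R) (beta_gt0 : 0 < beta) (beta_neq1 : beta != 1)
    (Rbeta : R) (Rbeta_gt0 : 0 < Rbeta) (Rbeta_lt1 : Rbeta < 1)
    (Rbeta_root : radius_equation beta Rbeta) :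
  (forall (a : 'rV[R[i]]_n) (F : X -> 'rV[R[i]]_n), bohr_mapping a F ->
     forall z : X, unit_ball X z -> rnorm z <= Rbeta ->
       (cesaro_majorant beta a F z <= (cesaro_bound beta (rnorm z))%:E)%E) /\
  (forall R' : R, Rbeta < R' -> R' < 1 ->
     exists (a : 'rV[R[i]]_n) (F : X -> 'rV[R[i]]_n) (z : X),
       [/\ bohr_mapping a F, unit_ball X z, rnorm z <= R' &
           ~ (cesaro_majorant beta a F z
                <= (cesaro_bound beta (rnorm z))%:E)%E]).
Proof.
move/bohr_gap_radius : Rbeta_root => /(_ beta_gt0 beta_neq1) g0.
have [pos neg] := bohr_gap_sign beta_gt0 beta_neq1 Rbeta_gt0 Rbeta_lt1 g0.
split=> [a F bF z zB zR|R' RR' R'1].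
  by apply: cesaro_majorant_le => //; apply: pos => //; exact: rnorm_ge0.
have [a [F [z [bF zB zR nle]]]] :=
  bohr_radius_sharp beta_gt0 beta_neq1 X_neq0 n_ge1
    (lt_trans Rbeta_gt0 RR') R'1 (neg _ RR' R'1).
by exists a, F, z; split => //; rewrite zR.
Qed.
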